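(* Let $f\colon M^n(c)\to\mathbb{S}^{2n+1}_\epsilon(c)$ be a horizontal isometric immersion of a Riemannian manifold of constant sectional curvature $c$ with index of relative nullity $\nu_f\equiv0$. Then any $P$-transform $\tilde f=\mathcal{R}_{\varphi,\beta,\Omega,P}(f)\colon\tilde M^n(c)\to\mathbb{S}^{2n+1}_\epsilon(c)$ of $f$ is also horizontal.
   Context: For $\epsilon=\pm1$, $\mathbb{C}^{n+1}_\epsilon$ is complex $(n+1)$-space with the pseudo-Euclidean metric $g_\epsilon=\epsilon\,dz_1d\bar z_1+\sum_{j=2}^{n+1}dz_jd\bar z_j$, and $\mathbb{S}^{2n+1}_\epsilon(c)=\{z\in\mathbb{C}^{n+1}_\epsilon:g_\epsilon(z,z)=1/c\}$ with $\epsilon c>0$ (Euclidean sphere if $\epsilon=1$, anti-de Sitter space if $\epsilon=-1$), of constant sectional curvature $c$. $\tilde J$ is multiplication by the imaginary unit on $\mathbb{C}^{n+1}_\epsilon$ and $\phi$ its projection onto the tangent bundle of $\mathbb{S}^{2n+1}_\epsilon(c)$. An isometric immersion $f\colon M^n\to\mathbb{S}^{2n+1}_\epsilon(c)$ of a Riemannian manifold is horizontal if the structure vector field $\xi_f=\sqrt{|c|}\,\tilde Jf$ is everywhere normal to $f$. $\nu_f(x)$ is the dimension of the kernel of the second fundamental form of $f$ at $x$. $i\colon\mathbb{S}^{2n+1}_\epsilon(c)\to\mathbb{C}^{n+1}_\epsilon$ is the inclusion and $F=i\circ f$. $N_fM$, $\nabla^\perp$, $\alpha$, $A_\xi$ are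 the normal bundle, normal connection, second fundamental form and shape operators of $f$; superscript $t$ denotes transpose. Vectorial Ribaucour transform. Let $V$ be a (finite-dimensional) Euclidean vector space, identified with the trivial bundle $M\times V$ with its flat connection; $V^*\otimes V$ is identified with the endomorphisms of $V$. Let $\varphi\colon M\to V$ be smooth, $\omega=d\varphi$, $\langle\omega^t(v),X\rangle=\langle v,\omega(X)\rangle$, $\varphi^t(v)=\langle\varphi,v\rangle$, and let $\beta\in\Gamma(V^*\otimes N_fM)$ satisfy $\alpha(X,\omega^t(v))+(\nabla_X\beta)v=0$ (with $(\nabla_X\beta)v=\nabla^\perp_X(\beta(v))-\beta(\nabla_Xv)$) and $[\Phi_u,\Phi_v]=0$ for all $X,u,v$, where $\Phi_vX=\Phi(X)(v)=(\nabla_X\omega^t)v-A_{\beta(v)}X+c\,\varphi^t(v)X$. Put $\mathcal{G}=F_*\omega^t+i_*\beta+cF\varphi^t$ and let $\Omega\in\Gamma(V^*\otimes V)$ be everywhere invertible with $d\Omega=\mathcal{G}^td\mathcal{G}$ and $\Omega+\Omega^t=\mathcal{G}^t\mathcal{G}$. The vectorial Ribaucour transform $\tilde f=\mathcal{R}_{\varphi,\beta,\Omega}(f)$ is defined by $i\circ\tilde f=F-\mathcal{G}\Omega^{-1}\varphi$ on the set $\tilde M^n$ of its regular points, with the induced metric. $P$-transform. For $f\colon M^n(c)\to\mathbb{S}^{2n+1}_\epsilon(c)$ horizontal, $\tilde f=\mathcal{R}_{\varphi,\beta,\Omega}(f)$ is a $P$-transform of $f$, written $\mathcal{R}_{\varphi,\beta,\Omega,P}(f)$,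 if there is $P\in V^*\otimes V$ with $\sigma(P)\cap(-\sigma(P))=\emptyset$ ($\sigma(P)$ the set of complex eigenvalues of $P$) such that $\beta=(\phi f_*\omega^t+\epsilon\sqrt{|c|}\,\xi_f\varphi^t)P$ and $\Omega^tP+P^t\Omega^t+T\rho=0$, where $T=-P^t-(P^t)^{-1}$ and $\rho=P^t\omega\omega^tP+cP^t\varphi\varphi^tP=\beta^t\beta$. *)

(* Defs.v *)
From HB Require Import structures.
From mathcomp Require Import all_boot all_order all_algebra.
From mathcomp Require Import complex.
From mathcomp Require Import all_classical all_reals all_analysis.

Set Implicit Arguments.
Unset Strict Implicit.
Unset Printing Implicit Defensive.

Import Order.TTheory GRing.Theory Num.Theory.
Import numFieldNormedType.Exports.

Local Open Scope classical_set_scope.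
Local Open Scope ring_scope.

(** * Smooth maps between open subsets of normed spaces *)

(* Class C^k on the open set D. *)
Fixpoint Ck (R : realType) (U W : normedModType R) (k : nat) (D : set U)
    (h : U -> W) {struct k} : Prop :=
  match k with
  | 0%N => forall x, D x -> {for x, continuous h}
  | k'.+1 => (forall x, D x -> differentiable h x) /\
             (forall v : U, Ck k' D (fun x => 'D_v h x))
  end.

Definition Csmooth (R : realType) (U W : normedModType R) (D : set U)
  (h : U -> W) : Prop := forall k, Ck k D h.

(** * Smooth manifolds *)

(* [cinv] is a total function; only its values on [cmap @` cdom] matter. *)
Record chart (R : realType) (n : nat) (M : topologicalType) := Chart {
  cdom : set M;
  cmap : M -> 'cV[R]_n;
  cinv : 'cV[R]_n -> M;
  cdom_open : open cdom;
  cimg_open : open (cmap @` cdom);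
  cmapK : forall x, cdom x -> cinv (cmap x) = x;
  cmap_continuous : forall x, cdom x -> {for x, continuous cmap};
  cinv_continuous : forall y, (cmap @` cdom) y -> {for y, continuous cinv}
}.

Record smooth_manifold (R : realType) (n : nat) (M : topologicalType)
    (A : set (chart R n M)) : Prop := {
  mfd_hausdorff : hausdorff_space M;
  mfd_second_countable : @second_countable M;
  mfd_cover : forall x, exists2 e, A e & cdom e x;
  mfd_transition : forall e e', A e -> A e' ->
    Csmooth (cmap e @` (cdom e `&` cdom e')) (cmap e' \o cinv e)
}.

(* Below, U is an open subset of M, regarded as a manifold with the restricted
   charts; a predicate relative to U only concerns that manifold. *)
Section Manifold.
Variables (R : realType) (n : nat) (M : topologicalType).
Implicit Types (e : chart R n M) (A : set (chart R n M)) (U : set M) (x : M).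

(* Tangent vectors at a point of [cdom e] are given by their components
   X : 'cV_n in the coordinate frame of e.  [dd e X h] is the derivative of h
   along the vector field on [cdom e] with constant components X; these fields
   span the tangent spaces and commute, so tensorial identities need only be
   written for them. *)
Definition dd (W : normedModType R) e (X : 'cV[R]_n) (h : M -> W) (x : M) : W :=
  'D_X (h \o cinv e) (cmap e x).

Definition dmx (p : nat) e (h : M -> 'cV[R]_p) (x : M) : 'M[R]_(p, n) :=
  \matrix_(a, i) (dd e (delta_mx i 0) h x) a 0.

Definition smooth_map (W : normedModType R) A U (h : M -> W) : Prop :=
  forall e, A e -> Csmooth (cmap e @` (cdom e `&` U)) (h \o cinv e).

(** ** Riemannian metrics *)

(* [g e x] is the Gram matrix of the coordinate frame of e at x. *)
Definition metric : Type := chart R n M -> M -> 'M[R]_n.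

Definition gin (g : metric) e x (X Y : 'cV[R]_n) : R := (X^T *m g e x *m Y) 0 0.

Record riemannian_metric A U (g : metric) : Prop := {
  rm_smooth : forall e, A e -> Csmooth (cmap e @` (cdom e `&` U)) (g e \o cinv e);
  rm_sym : forall e x, A e -> cdom e x -> U x -> (g e x)^T = g e x;
  rm_pos : forall e x X, A e -> cdom e x -> U x -> X != 0 -> 0 < gin g e x X X;
  rm_tensor : forall e e' x, A e -> A e' -> cdom e x -> cdom e' x -> U x ->
    g e x = (dmx e (cmap e') x)^T *m g e' x *m dmx e (cmap e') x
}.

(* Koszul formula for coordinate fields:
   2 <christoffel X Y, Z> = X <Y, Z> + Y <X, Z> - Z <X, Y>. *)
Definition christoffel (g : metric) e (X Y : 'cV[R]_n) (x : M) : 'cV[R]_n :=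
  2^-1 *: (invmx (g e x) *m
    (dd e X (g e) x *m Y + dd e Y (g e) x *m X
     - \col_l (X^T *m dd e (delta_mx l 0) (g e) x *m Y) 0 0)).

(* Levi-Civita derivative of the vector field with components Y. *)
Definition nabla (g : metric) e (X : 'cV[R]_n) (Y : M -> 'cV[R]_n) (x : M) :
    'cV[R]_n :=
  dd e X Y x + christoffel g e X (Y x) x.

Definition riem (g : metric) e (X Y Z : 'cV[R]_n) (x : M) : 'cV[R]_n :=
  nabla g e X (nabla g e Y (fun=> Z)) x - nabla g e Y (nabla g e X (fun=> Z)) x.

Definition sectional_curvature (g : metric) e x (X Y : 'cV[R]_n) : R :=
  gin g e x (riem g e X Y Y x) X
  / (gin g e x X X * gin g e x Y Y - gin g e x X Y ^+ 2).

Definition constant_curvature A U (g : metric) (c : R) : Prop :=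
  forall e x X Y, A e -> cdom e x -> U x -> \rank (row_mx X Y) = 2%N ->
  sectional_curvature g e x X Y = c.

End Manifold.

(** * The pseudo-Euclidean space C^(n+1)_eps and its quadric *)

(* The point (z_1, ..., z_(n+1)) with z_j = x_j + i y_j is the real column
   vector [col_mx x y]. *)
Notation Cdim n := (n.+1 + n.+1)%N.

Section Ambient.
Variables (R : realType) (n : nat) (eps c : R).
Local Notation E := 'cV[R]_(Cdim n).

Definition gramC : 'M[R]_(Cdim n) :=
  let d := \row_(j < n.+1) (if j == ord0 then eps else 1) in
  diag_mx (row_mx d d).

Definition inner (u v : E) : R := (u^T *m gramC *m v) 0 0.

Definition Jmx : 'M[R]_(Cdim n) := block_mx 0 (- 1%:M) 1%:M 0.

(* Adjoint of a linear map R^k -> C^(n+1)_eps, R^k Euclidean. *)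
Definition adjC (k : nat) (B : 'M[R]_(Cdim n, k)) : 'M[R]_(k, Cdim n) :=
  B^T *m gramC.

Definition in_quadric (z : E) : Prop := inner z z = c^-1.

(* Orthogonal projection onto the tangent space of the quadric at z. *)
Definition quadric_proj (z w : E) : E := w - (c * inner z w) *: z.

Definition phi_op (z w : E) : E := quadric_proj z (Jmx *m w).

Definition xi_at (z : E) : E := Num.sqrt `|c| *: (Jmx *m z).

End Ambient.

(** * Immersions into the quadric *)

(* A map f into the quadric is given by F = i \o f, with values in C^(n+1);
   tangent vectors of the quadric are likewise seen as vectors of C^(n+1). *)
Section Immersion.
Variables (R : realType) (n : nat) (M : topologicalType) (eps c : R).
Local Notation E := 'cV[R]_(Cdim n).
Variables (A : set (chart R n M)) (U : set M) (g : metric R n M) (F : M -> E).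
Implicit Types (e : chart R n M) (x : M) (X Y : 'cV[R]_n).

Definition induced_metric : metric R n M := fun e x =>
  (dmx e F x)^T *m gramC n eps *m dmx e F x.

Record isometric_immersion : Prop := {
  ii_smooth : smooth_map A U F;
  ii_quadric : forall x, U x -> in_quadric eps c (F x);
  ii_isometric : forall e x, A e -> cdom e x -> U x -> induced_metric e x = g e x
}.

Definition horizontal : Prop := forall e x X, A e -> cdom e x -> U x ->
  inner eps (xi_at c (F x)) (dd e X F x) = 0.

(* Components of the orthogonal projection of w onto f_* T_x M. *)
Definition tangent_part e x (w : E) : 'cV[R]_n :=
  invmx (g e x) *m (dmx e F x)^T *m gramC n eps *m w.

(* The component normal to f of a vector w tangent to the quadric. *)
Definition normal_part e x (w : E) : E := w - dmx e F x *m tangent_part e x w.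

(* Levi-Civita connection of the quadric along f. *)
Definition quadric_nabla e X (W : M -> E) (x : M) : E :=
  quadric_proj eps c (F x) (dd e X W x).

Definition sff e X Y (x : M) : E :=
  normal_part e x (quadric_nabla e X (dd e Y F) x).

(* Normal connection, for W a local section of the normal bundle. *)
Definition nabla_perp e X (W : M -> E) (x : M) : E :=
  normal_part e x (quadric_nabla e X W x).

(* <shape e x w X, Y> = <sff e X Y x, w> *)
Definition shape e x (w : E) X : 'cV[R]_n :=
  invmx (g e x) *m \col_l inner eps (sff e X (delta_mx l 0) x) w.

(* The matrix of the map X |-> sff X (as row vectors). *)
Definition sff_mx e x : 'M[R]_(n, n * Cdim n) :=
  \matrix_(i < n)
    mxvec (\matrix_(j < n, a < Cdim n)
      (sff e (delta_mx i 0) (delta_mx j 0) x) a 0).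

Definition relative_nullity e x : nat := \rank (kermx (sff_mx e x)).

Definition regular_points : set M :=
  [set x | forall e, A e -> cdom e x -> \rank (dmx e F x) = n].

End Immersion.

(** * The vectorial Ribaucour transformation *)

(* V is R^k with its standard inner product; endomorphisms of V and sections of
   V^* (x) W are matrices acting on the left of column vectors.  As V carries
   the flat connection, v : 'cV_k stands for a parallel section, so that
   (nabla_X beta) v = nabla_perp_X (beta v)
   and (nabla_X omega^t) v = nabla_X (omega^t v). *)
Section Ribaucour.
Variables (R : realType) (n k : nat) (M : topologicalType) (eps c : R).
Local Notation E := 'cV[R]_(Cdim n).
Variables (A : set (chart R n M)) (g : metric R n M) (F : M -> E).
Variables (phi : M -> 'cV[R]_k) (beta : M -> 'M[R]_(Cdim n, k))
  (Omega : M -> 'M[R]_k).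
Implicit Types (e : chart R n M) (x : M) (X : 'cV[R]_n) (u v : 'cV[R]_k).

(* The adjoint of omega = d phi with respect to g. *)
Definition omega_t e x : 'M[R]_(n, k) := invmx (g e x) *m (dmx e phi x)^T.

Definition Phi e x v X : 'cV[R]_n :=
  nabla g e X (fun y => omega_t e y *m v) x
  - shape eps c g F e x (beta x *m v) X
  + (c * ((phi x)^T *m v) 0 0) *: X.

(* F_* omega^t + i_* beta + c F phi^t; this section over M does not depend on
   the chart in which it is computed. *)
Definition calG e x : 'M[R]_(Cdim n, k) :=
  dmx e F x *m omega_t e x + beta x + c *: (F x *m (phi x)^T).

Record ribaucour_data : Prop := {
  rd_phi_smooth : smooth_map A setT phi;
  rd_beta_smooth : smooth_map A setT beta;
  rd_Omega_smooth : smooth_map A setT Omega;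
  rd_beta_quadric : forall x v, inner eps (F x) (beta x *m v) = 0;
  rd_beta_normal : forall e x X v, A e -> cdom e x ->
    inner eps (dd e X F x) (beta x *m v) = 0;
  rd_beta : forall e x X v, A e -> cdom e x ->
    sff eps c g F e X (omega_t e x *m v) x
    + nabla_perp eps c g F e X (fun y => beta y *m v) x = 0;
  rd_Phi_comm : forall e x u v X, A e -> cdom e x ->
    Phi e x u (Phi e x v X) = Phi e x v (Phi e x u X);
  rd_Omega_unit : forall x, Omega x \in unitmx;
  rd_Omega_diff : forall e x X, A e -> cdom e x ->
    dd e X Omega x = adjC eps (calG e x) *m dd e X (calG e) x;
  rd_Omega_sym : forall e x, A e -> cdom e x ->
    Omega x + (Omega x)^T = adjC eps (calG e x) *m calG e x
}.

Definition ribaucour_transform (Ft : M -> E) : Prop :=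
  ribaucour_data /\
  forall e x, A e -> cdom e x ->
    Ft x = F x - calG e x *m invmx (Omega x) *m phi x.

Definition complex_eigenvalue (P : 'M[R]_k) (z : R[i]%C) : Prop :=
  exists2 v : 'cV[R[i]%C]_k, v != 0 & map_mx (real_complex R) P *m v = z *: v.

Definition P_rho (P : 'M[R]_k) e x : 'M[R]_k :=
  P^T *m dmx e phi x *m omega_t e x *m P
  + c *: (P^T *m phi x *m (phi x)^T *m P).

Definition P_T (P : 'M[R]_k) : 'M[R]_k := - P^T - invmx P^T.

Definition P_beta (P : 'M[R]_k) e x v : E :=
  phi_op eps c (F x) (dmx e F x *m (omega_t e x *m (P *m v)))
  + (eps * Num.sqrt `|c| * ((phi x)^T *m (P *m v)) 0 0) *: xi_at c (F x).

(* Ft = R_(phi, beta, Omega, P)(f) *)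
Record P_transform (P : 'M[R]_k) (Ft : M -> E) : Prop := {
  pt_ribaucour : ribaucour_transform Ft;
  pt_spectrum : forall z, complex_eigenvalue P z -> ~ complex_eigenvalue P (- z);
  pt_beta : forall e x v, A e -> cdom e x -> beta x *m v = P_beta P e x v;
  pt_Omega : forall e x, A e -> cdom e x ->
    (Omega x)^T *m P + P^T *m (Omega x)^T + P_T P *m P_rho P e x = 0
}.

End Ribaucour.

(* Main.v *)
Require Import Defs.
From HB Require Import structures.
From mathcomp Require Import all_boot all_order all_algebra.
From mathcomp Require Import complex.
From mathcomp Require Import all_classical all_reals all_analysis.
From mathcomp Require Import ring lra.
Set Implicit Arguments.
Unset Strict Implicit.
Unset Printing Implicit Defensive.
Import Order.TTheory GRing.Theory Num.Theory.
Import numFieldNormedType.Exports.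
Local Open Scope classical_set_scope.
Local Open Scope ring_scope.

(** Write F, B = dF and < , > for the map into the flat space, its differential in
    a chart and the flat metric, J for the complex structure, Gm for the section
    F_* omega^t + beta + c F phi^t, and put Q = 1 - Gm Omega^-1 Gm^t.

    Horizontality.  The symmetric part of Omega is half of Gm^t Gm, so Q is an
    isometry of the flat space, as a reflection would be
    (ribaucour_op_isometry).  It maps F to F~.  The conditions on beta say that
    dGm(X) v = F_* Phi_v X (dd_calG_tangent); with d Omega = Gm^t dGm this gives
    dF~ = Q F_* D with D = 1 - Phi_(Omega^-1 phi) (dd_transform), and the metric
    of F~ is D^t g D.  Hence F~ is horizontal as soon as <JQF, QF_*Y> = 0 for all
    Y.  Since f is horizontal, F_* T is isotropic for J (differentiate
    <JF, F_*Y> = 0 and antisymmetrize), and a P-transform has Gm = S + JSP with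
    S = F_* omega^t + c F phi^t, S^t J S = 0.  Expanding, the condition becomes
    Omega^t P - P^t Omega + P^t N - N P = 0 with N = S^t S, which is the
    equation imposed on Omega (P_condition, ribaucour_horizontal_at).  The
    hypothesis on the spectrum enters through the invertibility of P.

    Curvature.  For a horizontal map, T, JT, F and JF fill the ambient space by
    dimension (horizontal_frame_complete), so the second fundamental form in the
    quadric is J F_*(X.Y) for a product X.Y on the tangent space, commutative and
    with totally symmetric <X.Y, Z> (flat_sff_horizontal).  By the Gauss
    equation, the curvature is c exactly when <X.X, Y.Y> = <X.Y, X.Y>
    (horizontal_curvature), which polarizes to associativity
    (flat_product_assoc).  Vanishing relative nullity means that no vector
    annihilates the product, and then the products span the tangent space.

    The second derivatives of Gm commute, which makes Phi_v self-adjoint with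
    X.Phi_v Y = Y.Phi_v X; so Phi_v commutes with all multiplications
    (Phi_mx_multiplier), and so does D.  The cubic form of F~ therefore satisfies
    C~(X.W, Y, Z) = C~(X, W.Y, Z), and if X*Y denotes the product of F~, then
    X*(Y*(Z.W)) = (X.Y)*(Z*W) is symmetric in X and Y
    (invariant_product_flat).  As the products Z.W span, the multiplications of
    F~ commute, which is the flatness needed for curvature c.  No principal
    directions have to be diagonalized. *)

(** * Calculus of smooth maps *)

Section NearEq.
Variables (R : realType) (U W : normedModType R).

Lemma near_eq_differentiable (f g : U -> W) (x : U) :
  {near x, f =1 g} -> differentiable f x -> differentiable g x.
Proof.
move=> fg df; apply/diffP => /=.
apply: (@getPex _ (fun dg : {linear U -> W} => continuous dg /\
  forall y, g y = g (lim (nbhs x)) + dg (y - lim (nbhs x))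
                  +o_(y \near x) (y - lim (nbhs x)))).
exists ('d f x); split; first exact: diff_continuous.
have /diffE dfx := df; rewrite lim_id //; apply/funeqP; apply/eqaddoP => eps eps0.
have /funeqP/eqaddoP/(_ _ eps0) := dfx; rewrite lim_id // => dfe.
near=> y; have -> : (g - (fun y => g x + 'd f x (y - x))) y =
    (f - (fun y => f x + 'd f x (y - x))) y.
  rewrite !fctE -(nbhs_singleton fg); congr (_ - _).
  by apply/esym; near: y.
by near: y.
Unshelve. all: by end_near. Qed.

End NearEq.

Section CkTheory.
Variables (R : realType) (U : normedModType R).
Implicit Types (k : nat) (D : set U).

Lemma CkS (W : normedModType R) k D (h : U -> W) : Ck k.+1 D h -> Ck k D h.
Proof.
elim: k h => [|k IH] h [hd hD]; first by move=> x /hd /differentiable_continuous.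
by split=> // v; apply: IH; apply: hD.
Qed.

Lemma Ck_sub (W : normedModType R) k D D' (h : U -> W) :
  D' `<=` D -> Ck k D h -> Ck k D' h.
Proof.
move=> DD'; elim: k h => [|k IH] h /=; first by move=> hc x /DD'; exact: hc.
by case=> hd hD; split=> [x /DD'|v]; [exact: hd | exact/IH/hD].
Qed.

Lemma Ck_ext (W : normedModType R) k D (h1 h2 : U -> W) :
  open D -> (forall x, D x -> h1 x = h2 x) -> Ck k D h1 -> Ck k D h2.
Proof.
move=> oD; elim: k h1 h2 => [|k IH] h1 h2 h12 /=.
  move=> hc x Dx; rewrite /prop_for /continuous_at -(h12 x Dx).
  apply: cvg_trans (hc x Dx); apply: near_eq_cvg.
  by apply: filterS (open_nbhs_nbhs (conj oD Dx)) => y; exact: h12.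
have h12n x : D x -> {near x, h1 =1 h2}.
  by move=> Dx; apply: filterS (open_nbhs_nbhs (conj oD Dx)) => y; exact: h12.
case=> hd hD; split=> [x Dx|v]; first exact: near_eq_differentiable (h12n x Dx) (hd x Dx).
by apply: IH (hD v) => x Dx; apply: near_eq_derive; exact: h12n.
Qed.

Lemma Ck_cst (W : normedModType R) k D (a : W) : Ck k D (fun=> a).
Proof.
elim: k a => [|k IH] a /=; first by move=> x _; exact: cvg_cst.
split=> [x _|v]; first exact: differentiable_cst.
under eq_fun do rewrite derive_cst.
exact: IH.
Qed.

Lemma CkD (W : normedModType R) k D (f g : U -> W) : open D ->
  Ck k D f -> Ck k D g -> Ck k D (fun x => f x + g x).
Proof.
move=> oD; elim: k f g => [|k IH] f g /=.
  by move=> fc gc x Dx; apply: continuousD; [exact: fc | exact: gc].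
move=> [fd fD] [gd gD]; split=> [x Dx|v].
  by apply: differentiableD; [exact: fd | exact: gd].
apply: Ck_ext (IH _ _ (fD v) (gD v)) => // x Dx.
by rewrite deriveD //; apply: diff_derivable; [exact: fd | exact: gd].
Qed.

Lemma CkM k D (f g : U -> R) : open D ->
  Ck k D f -> Ck k D g -> Ck k D (fun x => f x * g x).
Proof.
move=> oD; elim: k f g => [|k IH] f g fk gk.
  by move=> x Dx; apply: continuousM; [exact: fk | exact: gk].
move: (fk) (gk) => [fd fD] [gd gD]; split=> [x Dx|v].
  by apply: differentiableM; [exact: fd | exact: gd].
have := CkD oD (IH _ _ (CkS fk) (gD v)) (IH _ _ (CkS gk) (fD v)).
apply: Ck_ext => // x Dx.
by rewrite deriveM //; apply: diff_derivable; [exact: fd | exact: gd].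
Qed.

Lemma CkN (W : normedModType R) k D (f : U -> W) : open D ->
  Ck k D f -> Ck k D (fun x => - f x).
Proof.
move=> oD; elim: k f => [|k IH] f /=.
  by move=> fc x Dx; apply: continuousN; exact: fc.
move=> [fd fD]; split=> [x Dx|v]; first by apply: differentiableN; exact: fd.
apply: Ck_ext (IH _ (fD v)) => // x Dx.
by rewrite deriveN //; apply: diff_derivable; exact: fd.
Qed.

Lemma CkV k D (f : U -> R) : open D -> (forall x, D x -> f x != 0) ->
  Ck k D f -> Ck k D (fun x => (f x)^-1).
Proof.
move=> oD f0; elim: k => [|k IH] fk.
  by move=> x Dx; apply: continuousV; [exact: f0 | exact: fk].
move: (fk) => [fd fD]; split=> [x Dx|v].
  by apply: differentiableV; [exact: fd | exact: f0].
have iv := IH (CkS fk).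
have := CkN oD (CkM oD (CkM oD iv iv) (fD v)).
apply: Ck_ext => // x Dx.
rewrite deriveV; [|exact: f0|by apply: diff_derivable; exact: fd].
by rewrite expr2 invfM scaleNr.
Qed.

Lemma Ck_sum (W : normedModType R) (I : Type) (r : seq I) (p : pred I) k D
    (F : I -> U -> W) : open D ->
  (forall i, Ck k D (F i)) -> Ck k D (fun x => \sum_(i <- r | p i) F i x).
Proof.
move=> oD hF; elim: r => [|i r IH].
  under eq_fun do rewrite big_nil; exact: Ck_cst.
under eq_fun do rewrite big_cons.
by case: (p i) => //; exact: CkD.
Qed.

Lemma Ck_prod (I : Type) (r : seq I) (p : pred I) k D
    (F : I -> U -> R) : open D ->
  (forall i, Ck k D (F i)) -> Ck k D (fun x => \prod_(i <- r | p i) F i x).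
Proof.
move=> oD hF; elim: r => [|i r IH].
  under eq_fun do rewrite big_nil; exact: Ck_cst.
under eq_fun do rewrite big_cons.
by case: (p i) => //; exact: CkM.
Qed.

End CkTheory.

Section MatrixCalculus.
Variables (R : realType) (U : normedModType R).

Lemma differentiable_entry p q (h : U -> 'M[R]_(p, q)) x i j :
  differentiable h x -> differentiable (fun y => h y i j) x.
Proof.
move=> hd; apply: (@differentiable_comp _ _ _ _ h (fun N => N i j)) => //.
exact: differentiable_coord.
Qed.

Lemma differentiable_mx p q (h : U -> 'M[R]_(p, q)) x :
  (forall i j, differentiable (fun y => h y i j) x) -> differentiable h x.
Proof.
move=> hd.
have -> : h = \sum_(i < p) \sum_(j < q) (fun y => h y i j *: delta_mx i j).
  apply/funext => y; rewrite fct_sumE [LHS]matrix_sum_delta.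
  by apply: eq_bigr => i _; rewrite fct_sumE.
apply: differentiable_sum => i; apply: differentiable_sum => j.
exact: differentiableZl.
Qed.

Lemma derive_entry p q (h : U -> 'M[R]_(p, q)) x v i j :
  differentiable h x -> ('D_v h x) i j = 'D_v (fun y => h y i j) x.
Proof. by move=> hd; rewrite derive_mx ?mxE //; exact: diff_derivable. Qed.

Lemma Ck_mxP p q k (D : set U) (h : U -> 'M[R]_(p, q)) : open D ->
  Ck k D h <-> forall i j, Ck k D (fun x => h x i j).
Proof.
move=> oD; elim: k h => [|k IH] h /=; split.
- move=> hc i j x Dx.
  apply: (@continuous_comp _ _ _ h (fun N : 'M[R]_(p, q) => N i j)).
    exact: hc.
  exact: coord_continuous.
- move=> hc x Dx; apply/cvgrPdist_le => eps eps0; near=> y.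
  rewrite /Num.Def.normr/= mx_normrE (bigmax_le _ (ltW eps0)) //= => i _.
  rewrite !mxE; move: i; near: y; apply: filter_forall => /= i.
  exact: (cvgrPdist_le _ _).1 (hc i.1 i.2 x Dx) _ eps0.
- case=> hd hD i j; split=> [x Dx|v]; first by apply: differentiable_entry; exact: hd.
  have /IH/(_ i j) := hD v; apply: Ck_ext => // x Dx.
  by rewrite derive_entry //; exact: hd.
- move=> hij; have hd x : D x -> differentiable h x.
    by move=> Dx; apply: differentiable_mx => i j; exact: (hij i j).1.
  split=> // v; apply/IH => i j; apply: Ck_ext ((hij i j).2 v) => // x Dx.
  by rewrite derive_entry //; exact: hd.
Unshelve. all: by end_near. Qed.

End MatrixCalculus.

Section MatrixSmooth.
Variables (R : realType) (U : normedModType R) (D : set U).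
Hypothesis oD : open D.

Lemma Csmooth_mulmx p q r (A : U -> 'M[R]_(p, q)) (B : U -> 'M[R]_(q, r)) :
  Csmooth D A -> Csmooth D B -> Csmooth D (fun x => A x *m B x).
Proof.
move=> hA hB k; apply/Ck_mxP => // i j.
under eq_fun do rewrite mxE.
apply: Ck_sum => // l; apply: CkM => //.
  by have /(Ck_mxP k A oD) := hA k.
by have /(Ck_mxP k B oD) := hB k.
Qed.

Lemma Csmooth_tr p q (A : U -> 'M[R]_(p, q)) :
  Csmooth D A -> Csmooth D (fun x => (A x)^T).
Proof.
move=> hA k; apply/Ck_mxP => // i j.
under eq_fun do rewrite mxE.
by have /(Ck_mxP k A oD) := hA k.
Qed.

Lemma Csmooth_det p (A : U -> 'M[R]_p) :
  Csmooth D A -> Csmooth D (fun x => \det (A x)).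
Proof.
move=> hA k; rewrite /determinant; apply: Ck_sum => // s; apply: CkM => //.
  exact: Ck_cst.
by apply: Ck_prod => // i; have /(Ck_mxP k A oD) := hA k.
Qed.

Lemma Csmooth_invmx p (A : U -> 'M[R]_p) :
  (forall x, D x -> A x \in unitmx) ->
  Csmooth D A -> Csmooth D (fun x => invmx (A x)).
Proof.
move=> uA hA k; apply/Ck_mxP => // i j.
apply: (@Ck_ext _ _ _ _ _ (fun x => (\det (A x))^-1 * cofactor (A x) j i)) => //.
  by move=> x Dx; rewrite /invmx uA // !mxE.
apply: CkM => //.
  apply: CkV => //; last exact: Csmooth_det.
  by move=> x /uA; rewrite unitmxE unitfE.
rewrite /cofactor; apply: CkM => //; first exact: Ck_cst.
apply: (Csmooth_det _ _) => l; apply/Ck_mxP => // a b.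
under eq_fun do rewrite !mxE.
by have /(Ck_mxP l A oD) := hA l.
Qed.

Lemma differentiable_mulmx p q r (A : U -> 'M[R]_(p, q))
    (B : U -> 'M[R]_(q, r)) x :
  differentiable A x -> differentiable B x ->
  differentiable (fun y => A y *m B y) x.
Proof.
move=> dA dB; apply: differentiable_mx => i j.
have -> : (fun y => (A y *m B y) i j) =
    \sum_l ((fun y => A y i l) * (fun y => B y l j)).
  by apply/funext => y; rewrite mxE fct_sumE.
apply: differentiable_sum => l.
by apply: differentiableM; exact: differentiable_entry.
Qed.

Lemma derive_mulmx p q r (A : U -> 'M[R]_(p, q)) (B : U -> 'M[R]_(q, r)) x v :
  differentiable A x -> differentiable B x ->
  'D_v (fun y => A y *m B y) x = 'D_v A x *m B x + A x *m 'D_v B x.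
Proof.
move=> dA dB; apply/matrixP => i j.
rewrite derive_entry; last exact: differentiable_mulmx.
have -> : (fun y => (A y *m B y) i j) =
    \sum_l ((fun y => A y i l) * (fun y => B y l j)).
  by apply/funext => y; rewrite mxE fct_sumE.
have dAl l : derivable (fun y => A y i l) x v.
  exact/diff_derivable/differentiable_entry.
have dBl l : derivable (fun y => B y l j) x v.
  exact/diff_derivable/differentiable_entry.
rewrite derive_sum; last by move=> l; exact: derivableM.
rewrite !mxE -big_split /=; apply: eq_bigr => l _.
rewrite deriveM // -!derive_entry // addrC; congr (_ + _).
by rewrite /GRing.scale /= mulrC.
Qed.

Lemma derive_trmx p q (A : U -> 'M[R]_(p, q)) x v :
  differentiable A x -> 'D_v (fun y => (A y)^T) x = ('D_v A x)^T.
Proof.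
move=> dA; have dAt : differentiable (fun y => (A y)^T) x.
  apply: differentiable_mx => i j; under eq_fun do rewrite mxE.
  exact: differentiable_entry.
apply/matrixP => i j; rewrite derive_entry // mxE derive_entry //.
by under eq_fun do rewrite mxE.
Qed.

End MatrixSmooth.

Lemma derive_mx_coords (R : realType) n (W : normedModType R)
    (h : 'cV[R]_n -> W) x (X : 'cV[R]_n) : differentiable h x ->
  'D_X h x = \sum_i X i 0 *: 'D_(delta_mx i 0) h x.
Proof.
move=> dh; rewrite deriveE // [in LHS](matrix_sum_delta X) linear_sum.
apply: eq_bigr => i _; rewrite big_ord1 linearZ /=.
by rewrite deriveE.
Qed.

Lemma derive_comp (R : realType) (U V W : normedModType R) (f : U -> V)
    (g : V -> W) x v : differentiable f x -> differentiable g (f x) ->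
  'D_v (g \o f) x = 'D_('D_v f x) g (f x).
Proof.
move=> df dg; rewrite deriveE; last exact: differentiable_comp.
by rewrite diff_comp // [in RHS]deriveE // deriveE.
Qed.

(** ** Symmetry of second derivatives *)

Section SecondDerivative.
Variables (R : realType) (U : normedModType R).

Lemma is_derive_line (f : U -> R) (u w : U) (a : R) :
  differentiable f (a *: u + w) ->
  is_derive a 1 (fun t : R => f (t *: u + w)) ('D_u f (a *: u + w)).
Proof.
move=> df.
have e : (fun h : R => h^-1 *: (((fun t : R => f (t *: u + w)) \o shift a)
      (h *: 1) - f (a *: u + w))) =
    (fun h : R => h^-1 *: ((f \o shift (a *: u + w)) (h *: u) - f (a *: u + w))).
  apply/funext => h /=; rewrite [h *: 1]mulr1.
  by rewrite scalerDl addrA.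
apply: DeriveDef; last by rewrite /derive e.
by rewrite /derivable e; exact: diff_derivable.
Qed.

(** Applying the mean value theorem once in each direction expresses the
    second difference by either of the two mixed derivatives. *)
Lemma second_difference (f : U -> R) (D : set U) (x u v : U) (s : R) :
  0 < s ->
  (forall a b, 0 <= a <= s -> 0 <= b <= s -> D (a *: u + (b *: v + x))) ->
  (forall y, D y -> differentiable f y) ->
  (forall y, D y -> differentiable ('D_u f) y) ->
  exists a b, [/\ 0 <= a <= s, 0 <= b <= s &
    f (s *: u + (s *: v + x)) - f (s *: u + x) - f (s *: v + x) + f x =
    s ^+ 2 * 'D_v ('D_u f) (a *: u + (b *: v + x))].
Proof.
move=> s0 hD df ddf.
have s00 : 0 <= s <= s by rewrite lexx ltW.
have o00 : 0 <= (0 : R) <= s by rewrite lexx ltW.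
have inab a : a \in `]0, s[%R -> 0 <= a <= s.
  by rewrite in_itv /= => /andP[? ?]; rewrite !ltW.
pose g (a : R) := f (a *: u + (s *: v + x)) - f (a *: u + x).
have hD0 a : 0 <= a <= s -> D (a *: u + x).
  by move=> ha; have := hD a 0 ha o00; rewrite scale0r add0r.
have dg a : 0 <= a <= s ->
    is_derive a 1 g ('D_u f (a *: u + (s *: v + x)) - 'D_u f (a *: u + x)).
  move=> ha; apply: is_deriveB; apply: is_derive_line; apply: df.
    exact: hD.
  exact: hD0.
have [||a /inab ha ga] := @MVT R g (fun a =>
    'D_u f (a *: u + (s *: v + x)) - 'D_u f (a *: u + x)) 0 s s0.
  by move=> a /inab; exact: dg.
  apply: derivable_within_continuous => a; rewrite in_itv /= => ha.
  by have [] := dg a ha.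
pose k (b : R) := 'D_u f (b *: v + (a *: u + x)).
have dk b : 0 <= b <= s -> is_derive b 1 k ('D_v ('D_u f) (b *: v + (a *: u + x))).
  move=> hb; apply: is_derive_line; apply: ddf.
  by rewrite addrCA; exact: hD.
have [||b /inab hb kb] := @MVT R k (fun b => 'D_v ('D_u f) (b *: v + (a *: u + x))) 0 s s0.
  by move=> b /inab; exact: dk.
  apply: derivable_within_continuous => b; rewrite in_itv /= => hb.
  by have [] := dk b hb.
exists a, b; split => //.
move: ga kb; rewrite /g /k !scale0r !add0r !subr0 => ga kb.
rewrite [a *: u + (b *: v + x)]addrCA expr2 -mulrA [X in s * X]mulrC -kb.
by rewrite [s *: v + (a *: u + x)]addrCA [RHS]mulrC -ga; ring.
Qed.

Lemma derive_symmetric_scalar (f : U -> R) (D : set U) (x u v : U) :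
  open D -> Ck 2 D f -> D x -> 'D_u ('D_v f) x = 'D_v ('D_u f) x.
Proof.
move=> oD [df ddf] Dx.
apply/eqP; rewrite -subr_eq0 -normr_le0; apply/ler_addgt0Pl => eps eps0.
rewrite addr0.
have e2 : 0 < eps / 2 by rewrite divr_gt0.
have cuv : \forall y \near x, `|'D_u ('D_v f) x - 'D_u ('D_v f) y| <= eps / 2.
  exact: (cvgrPdist_le _ _).1 ((ddf v).2 u x Dx) _ e2.
have cvu : \forall y \near x, `|'D_v ('D_u f) x - 'D_v ('D_u f) y| <= eps / 2.
  exact: (cvgrPdist_le _ _).1 ((ddf u).2 v x Dx) _ e2.
have /nbhs_ballP[r /= r0 hr] : \forall y \near x, D y /\
    (`|'D_u ('D_v f) x - 'D_u ('D_v f) y| <= eps / 2 /\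
     `|'D_v ('D_u f) x - 'D_v ('D_u f) y| <= eps / 2).
  have nD := open_nbhs_nbhs (conj oD Dx).
  move: nD cuv cvu; apply: filterS3 => y Dy huv hvu.
  exact (conj Dy (conj huv hvu)).
set N := `|u| + `|v| + 1.
have N0 : 0 < N by rewrite ltr_wpDl // addr_ge0.
(* The parallelogram on s u and s v stays in the ball of radius r. *)
pose s := r / 2 / N.
have s0 : 0 < s by rewrite !divr_gt0.
have hb a b : 0 <= a <= s -> 0 <= b <= s -> ball x r (a *: u + (b *: v + x)).
  move=> /andP[a0 ha] /andP[b0 hb]; rewrite -ball_normE /= addrA opprD addrCA subrr addr0 normrN.
  apply: le_lt_trans (ler_normD _ _) _; rewrite !normrZ !ger0_norm //.
  apply: (@le_lt_trans _ _ (s * (`|u| + `|v|))).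
    by rewrite mulrDr lerD // ler_wpM2r.
  apply: (@lt_le_trans _ _ (s * N)); first by rewrite ltr_pM2l // ltrDl.
  by rewrite /s divfK ?gt_eqF //; lra.
have [a [b [ha hb' E1]]] := @second_difference f (ball x r) x u v s s0 hb
  (fun y yr => df y (hr y yr).1) (fun y yr => (ddf u).1 y (hr y yr).1).
have hbC t t' : 0 <= t <= s -> 0 <= t' <= s -> ball x r (t *: v + (t' *: u + x)).
  by move=> ht ht'; rewrite addrCA; exact: hb.
have [a' [b' [ha' hb'' E2]]] := @second_difference f (ball x r) x v u s s0 hbC
  (fun y yr => df y (hr y yr).1) (fun y yr => (ddf v).1 y (hr y yr).1).
have E : 'D_v ('D_u f) (a *: u + (b *: v + x)) =
         'D_u ('D_v f) (a' *: v + (b' *: u + x)).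
  apply: (@mulfI _ (s ^+ 2)); first by rewrite expf_neq0 // gt_eqF.
  apply: etrans (esym E1) (etrans _ E2).
  by rewrite (addrCA (s *: v)) (addrAC (f _)).
have [_ [_ h1]] := hr _ (hb a b ha hb').
have [_ [h2 _]] := hr _ (hb b' a' hb'' ha').
rewrite [b' *: u + _]addrCA in h2.
rewrite /= E in h1; rewrite /= in h2; rewrite (splitr eps).
rewrite -(subrKA ('D_u ('D_v f) (a' *: v + (b' *: u + x)))).
rewrite distrC in h1; exact: le_trans (ler_normD _ _) (lerD h2 h1).
Qed.

Lemma derive_symmetric p q (h : U -> 'M[R]_(p, q)) (D : set U) (x u v : U) :
  open D -> Ck 2 D h -> D x -> 'D_u ('D_v h) x = 'D_v ('D_u h) x.
Proof.
move=> oD hk Dx; have [dh ddh] := hk.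
have entry w w' i j : ('D_w ('D_w' h) x) i j = 'D_w ('D_w' (fun y => h y i j)) x.
  apply: etrans (derive_entry w i j ((ddh w').1 x Dx)) _.
  apply: near_eq_derive; apply: filterS (open_nbhs_nbhs (conj oD Dx)) => y Dy.
  by rewrite derive_entry //; exact: dh.
apply/matrixP => i j; apply: etrans (entry u v i j) _.
apply: etrans _ (esym (entry v u i j)); apply: (derive_symmetric_scalar u v oD _ Dx).
by have /(Ck_mxP 2 h oD) := hk.
Qed.

End SecondDerivative.

Section ChartCalculus.
Variables (R : realType) (n : nat) (M : topologicalType).
Variables (e : chart R n M) (U : set M).
Hypothesis oU : open U.
Local Notation D := (cmap e @` (cdom e `&` U)).

Definition smooth_on (W : normedModType R) (h : M -> W) : Prop :=
  Csmooth D (h \o cinv e).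

Lemma open_chart_image : open D.
Proof.
rewrite openE => _ [x [ex Ux] <-].
have ix : (cmap e @` cdom e) (cmap e x) by exists x.
have nU : nbhs (cinv e (cmap e x)) U.
  by rewrite cmapK //; exact: open_nbhs_nbhs.
have := cinv_continuous ix nU.
have nI := open_nbhs_nbhs (conj (@cimg_open _ _ _ e) ix).
rewrite /interior /=; apply: filterS2 nI => y [z ez <-] /=.
by rewrite cmapK // => Uz; exists z.
Qed.
Let oD := open_chart_image.

Lemma cinvP (Q : M -> Prop) :
  (forall x, cdom e x -> U x -> Q x) -> forall y, D y -> Q (cinv e y).
Proof. by move=> hQ _ [x [ex Ux] <-]; rewrite cmapK //; exact: hQ. Qed.

Lemma smooth_on_ext (W : normedModType R) (h1 h2 : M -> W) :
  (forall x, cdom e x -> U x -> h1 x = h2 x) -> smooth_on h1 -> smooth_on h2.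
Proof.
move=> h12 s1 k; apply: (Ck_ext oD _ (s1 k)).
exact: (@cinvP (fun x => h1 x = h2 x)).
Qed.

Lemma dd_ext (W : normedModType R) (h1 h2 : M -> W) X x :
  (forall x, cdom e x -> U x -> h1 x = h2 x) -> cdom e x -> U x ->
  dd e X h1 x = dd e X h2 x.
Proof.
move=> h12 ex Ux; have Dx : D (cmap e x) by exists x.
apply: near_eq_derive.
by apply: filterS (open_nbhs_nbhs (conj oD Dx)); exact: (@cinvP (fun x => h1 x = h2 x)).
Qed.

Lemma smooth_on_diff (W : normedModType R) (h : M -> W) x :
  smooth_on h -> cdom e x -> U x -> differentiable (h \o cinv e) (cmap e x).
Proof. by move=> /(_ 1%N)[hd _] ex Ux; apply: hd; exists x. Qed.

Lemma smooth_on_dd (W : normedModType R) (h : M -> W) X :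
  smooth_on h -> smooth_on (dd e X h).
Proof.
move=> sh k; apply: (Ck_ext oD _ ((sh k.+1).2 X)) => _ [x [ex Ux] <-].
by rewrite /dd /= cmapK.
Qed.

Lemma smooth_on_cst (W : normedModType R) (a : W) : smooth_on (fun=> a).
Proof. by move=> k; exact: Ck_cst. Qed.

Lemma smooth_onD (W : normedModType R) (h1 h2 : M -> W) :
  smooth_on h1 -> smooth_on h2 -> smooth_on (fun x => h1 x + h2 x).
Proof. by move=> s1 s2 k; apply: CkD. Qed.

Lemma smooth_onN (W : normedModType R) (h : M -> W) :
  smooth_on h -> smooth_on (fun x => - h x).
Proof. by move=> sh k; apply: CkN. Qed.

Lemma smooth_onB (W : normedModType R) (h1 h2 : M -> W) :
  smooth_on h1 -> smooth_on h2 -> smooth_on (fun x => h1 x - h2 x).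
Proof. by move=> s1 s2; apply: smooth_onD => //; exact: smooth_onN. Qed.

Lemma smooth_on_mulmx p q r (h1 : M -> 'M[R]_(p, q)) (h2 : M -> 'M[R]_(q, r)) :
  smooth_on h1 -> smooth_on h2 -> smooth_on (fun x => h1 x *m h2 x).
Proof. by move=> s1 s2; apply: Csmooth_mulmx. Qed.

Lemma smooth_on_mulcst p q r (h : M -> 'M[R]_(p, q)) (C : 'M[R]_(q, r)) :
  smooth_on h -> smooth_on (fun x => h x *m C).
Proof. by move=> sh; apply: smooth_on_mulmx => //; exact: smooth_on_cst. Qed.

Lemma smooth_on_cstmul p q r (h : M -> 'M[R]_(q, r)) (C : 'M[R]_(p, q)) :
  smooth_on h -> smooth_on (fun x => C *m h x).
Proof. by move=> sh; apply: smooth_on_mulmx => //; exact: smooth_on_cst. Qed.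

Lemma smooth_onZ p q a (h : M -> 'M[R]_(p, q)) :
  smooth_on h -> smooth_on (fun x => a *: h x).
Proof.
move=> sh; apply: (@smooth_on_ext _ (fun x => a%:M *m h x)).
  by move=> x _ _; rewrite mul_scalar_mx.
exact: smooth_on_cstmul.
Qed.

Lemma smooth_on_tr p q (h : M -> 'M[R]_(p, q)) :
  smooth_on h -> smooth_on (fun x => (h x)^T).
Proof. by move=> sh; apply: Csmooth_tr. Qed.

Lemma smooth_on_invmx p (h : M -> 'M[R]_p) :
  (forall x, cdom e x -> U x -> h x \in unitmx) ->
  smooth_on h -> smooth_on (fun x => invmx (h x)).
Proof. by move=> uh sh; apply: Csmooth_invmx => //; exact: (@cinvP (fun x => h x \in unitmx)). Qed.

Lemma smooth_on_dmx p (h : M -> 'cV[R]_p) :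
  smooth_on h -> smooth_on (dmx e h).
Proof.
move=> sh k; apply/Ck_mxP => // a i.
have /(_ k)/Ck_mxP/(_ a 0) := smooth_on_dd (delta_mx i 0) sh.
move=> /(_ oD); apply: Ck_ext => // y _.
by rewrite /= mxE.
Qed.

Lemma dd_cst (W : normedModType R) (a : W) X x : dd e X (fun=> a) x = 0.
Proof. exact: derive_cst. Qed.

Lemma ddD (W : normedModType R) (h1 h2 : M -> W) X x :
  smooth_on h1 -> smooth_on h2 -> cdom e x -> U x ->
  dd e X (fun y => h1 y + h2 y) x = dd e X h1 x + dd e X h2 x.
Proof.
move=> s1 s2 ex Ux.
by apply: deriveD; apply: diff_derivable; apply: smooth_on_diff.
Qed.

Lemma ddN (W : normedModType R) (h : M -> W) X x :
  smooth_on h -> cdom e x -> U x ->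
  dd e X (fun y => - h y) x = - dd e X h x.
Proof.
by move=> sh ex Ux; apply: deriveN; apply: diff_derivable; apply: smooth_on_diff.
Qed.

Lemma ddB (W : normedModType R) (h1 h2 : M -> W) X x :
  smooth_on h1 -> smooth_on h2 -> cdom e x -> U x ->
  dd e X (fun y => h1 y - h2 y) x = dd e X h1 x - dd e X h2 x.
Proof.
move=> s1 s2 ex Ux; rewrite ddD //; last exact: smooth_onN.
by rewrite ddN.
Qed.

Lemma dd_mulmx p q r (h1 : M -> 'M[R]_(p, q)) (h2 : M -> 'M[R]_(q, r)) X x :
  smooth_on h1 -> smooth_on h2 -> cdom e x -> U x ->
  dd e X (fun y => h1 y *m h2 y) x = dd e X h1 x *m h2 x + h1 x *m dd e X h2 x.
Proof.
move=> s1 s2 ex Ux; rewrite /dd.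
rewrite -[h2 x in X in X + _](congr1 h2 (cmapK ex)).
rewrite -[h1 x in X in _ + X](congr1 h1 (cmapK ex)).
exact: derive_mulmx (smooth_on_diff s1 ex Ux) (smooth_on_diff s2 ex Ux).
Qed.

Lemma dd_mulmxl p q r (A : 'M[R]_(p, q)) (h : M -> 'M[R]_(q, r)) X x :
  smooth_on h -> cdom e x -> U x ->
  dd e X (fun y => A *m h y) x = A *m dd e X h x.
Proof.
move=> sh ex Ux; rewrite (dd_mulmx (h1 := fun=> A)) //.
  by rewrite dd_cst mul0mx add0r.
exact: smooth_on_cst.
Qed.

Lemma dd_mulmxr p q r (A : 'M[R]_(q, r)) (h : M -> 'M[R]_(p, q)) X x :
  smooth_on h -> cdom e x -> U x ->
  dd e X (fun y => h y *m A) x = dd e X h x *m A.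
Proof.
move=> sh ex Ux; rewrite (dd_mulmx (h2 := fun=> A)) //.
  by rewrite dd_cst mulmx0 addr0.
exact: smooth_on_cst.
Qed.

Lemma ddZ p q a (h : M -> 'M[R]_(p, q)) X x :
  smooth_on h -> cdom e x -> U x ->
  dd e X (fun y => a *: h y) x = a *: dd e X h x.
Proof.
move=> sh ex Ux; rewrite -mul_scalar_mx -(dd_mulmxl _ _ sh ex Ux).
by apply: dd_ext => // y _ _; rewrite mul_scalar_mx.
Qed.

Lemma dd_tr p q (h : M -> 'M[R]_(p, q)) X x :
  smooth_on h -> cdom e x -> U x ->
  dd e X (fun y => (h y)^T) x = (dd e X h x)^T.
Proof. by move=> sh ex Ux; exact: derive_trmx (smooth_on_diff sh ex Ux). Qed.

Lemma dd_coords (W : normedModType R) (h : M -> W) (X : 'cV[R]_n) x :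
  smooth_on h -> cdom e x -> U x ->
  dd e X h x = \sum_i X i 0 *: dd e (delta_mx i 0) h x.
Proof. by move=> sh ex Ux; exact: derive_mx_coords (smooth_on_diff sh ex Ux). Qed.

Lemma dmxE p (h : M -> 'cV[R]_p) (X : 'cV[R]_n) x :
  smooth_on h -> cdom e x -> U x -> dmx e h x *m X = dd e X h x.
Proof.
move=> sh ex Ux; rewrite dd_coords //; apply/colP => a.
rewrite mxE summxE; apply: eq_bigr => i _.
by rewrite !mxE mulrC.
Qed.

Lemma dd_symmetric p q (h : M -> 'M[R]_(p, q)) X Y x :
  smooth_on h -> cdom e x -> U x -> dd e X (dd e Y h) x = dd e Y (dd e X h) x.
Proof.
move=> sh ex Ux; have Dx : D (cmap e x) by exists x.
have step A B : dd e A (dd e B h) x = 'D_A ('D_B (h \o cinv e)) (cmap e x).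
  apply: near_eq_derive; apply: filterS (open_nbhs_nbhs (conj oD Dx)).
  by move=> _ [y [ey Uy] <-]; rewrite /dd /= cmapK.
rewrite (step X Y) (step Y X).
exact (derive_symmetric X Y oD (sh 2%N) Dx).
Qed.

Lemma dd_dd_dmx p (h : M -> 'cV[R]_p) X Y x :
  smooth_on h -> cdom e x -> U x ->
  dd e X (dd e Y h) x = dd e X (dmx e h) x *m Y.
Proof.
move=> sh ex Ux; rewrite -(dd_mulmxr _ _ (smooth_on_dmx sh) ex Ux).
by apply: dd_ext => // y ey Uy; rewrite (dmxE _ sh ey Uy).
Qed.

Lemma dd_dmxC p (h : M -> 'cV[R]_p) X Y x :
  smooth_on h -> cdom e x -> U x ->
  dd e X (dmx e h) x *m Y = dd e Y (dmx e h) x *m X.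
Proof.
move=> sh ex Ux.
exact (etrans (esym (dd_dd_dmx X Y sh ex Ux))
  (etrans (dd_symmetric X Y sh ex Ux) (dd_dd_dmx Y X sh ex Ux))).
Qed.

End ChartCalculus.

Lemma dd_invmx (R : realType) n (M : topologicalType) (e : chart R n M) (U : set M)
    p (h : M -> 'M[R]_p) X x : open U -> smooth_on e U h ->
  (forall y, cdom e y -> U y -> h y \in unitmx) -> cdom e x -> U x ->
  dd e X (fun y => invmx (h y)) x =
  - (invmx (h x) *m dd e X h x *m invmx (h x)).
Proof.
move=> oU sh uh ex Ux; have si := smooth_on_invmx oU uh sh.
have h1 y : cdom e y -> U y -> h y *m invmx (h y) = 1%:M.
  by move=> ey Uy; rewrite mulmxV ?uh.
have := etrans (esym (dd_mulmx X sh si ex Ux))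
  (etrans (dd_ext oU X h1 ex Ux) (dd_cst e _ X x)).
move: (dd e X h x) (dd e X _ x) (uh x ex Ux) => dh di uhx.
move=> /eqP; rewrite addrC addr_eq0 => /eqP /(congr1 (mulmx (invmx (h x)))).
by rewrite mulKmx // => ->; rewrite mulmxN mulmxA.
Qed.

(** * Bilinear forms *)

Section BilinearForm.
Variables (R : comUnitRingType) (m : nat) (S : 'M[R]_m).
Implicit Types u v w : 'cV[R]_m.

Definition bform u v : R := (u^T *m S *m v) 0 0.

Lemma bformDl u v w : bform (u + v) w = bform u w + bform v w.
Proof. by rewrite /bform linearD /= !mulmxDl mxE. Qed.

Lemma bformDr u v w : bform u (v + w) = bform u v + bform u w.
Proof. by rewrite /bform mulmxDr mxE. Qed.

Lemma bformZl a u v : bform (a *: u) v = a * bform u v.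
Proof. by rewrite /bform linearZ /= -!scalemxAl mxE. Qed.

Lemma bformZr a u v : bform u (a *: v) = a * bform u v.
Proof. by rewrite /bform -scalemxAr mxE. Qed.

Lemma bformNl u v : bform (- u) v = - bform u v.
Proof. by rewrite -scaleN1r bformZl mulN1r. Qed.

Lemma bformNr u v : bform u (- v) = - bform u v.
Proof. by rewrite -scaleN1r bformZr mulN1r. Qed.

Lemma bformBl u v w : bform (u - v) w = bform u w - bform v w.
Proof. by rewrite bformDl bformNl. Qed.

Lemma bformBr u v w : bform u (v - w) = bform u v - bform u w.
Proof. by rewrite bformDr bformNr. Qed.

Lemma bform0l u : bform 0 u = 0.
Proof. by rewrite -(scale0r 0) bformZl mul0r. Qed.

Definition bformE := (bformDl, bformDr, bformNl, bformNr, bformZl, bformZr).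

Lemma bformC : S^T = S -> forall u v, bform u v = bform v u.
Proof.
move=> Ssym u v; rewrite /bform.
have -> : v^T *m S *m u = (u^T *m S *m v)^T by rewrite !trmx_mul trmxK Ssym mulmxA.
by rewrite [RHS]mxE.
Qed.

Lemma bform_nondeg w : S \in unitmx -> (forall u, bform u w = 0) -> w = 0.
Proof.
move=> uS hw; rewrite -[w](mulKmx uS); suff -> : S *m w = 0 by rewrite mulmx0.
apply/colP => i; rewrite [RHS]mxE -(hw (delta_mx i 0)) /bform.
by rewrite trmx_delta -mulmxA -rowE [RHS]mxE.
Qed.

Lemma bform_eq v w : S \in unitmx -> (forall u, bform u v = bform u w) -> v = w.
Proof.
move=> uS hvw; apply: subr0_eq; apply: (bform_nondeg uS) => u.
by rewrite bformBr hvw subrr.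
Qed.

End BilinearForm.

Lemma bform_mull (R : comUnitRingType) m p (S : 'M[R]_m) (A : 'M[R]_(m, p)) u v :
  bform S (A *m u) v = (u^T *m (A^T *m S *m v)) 0 0.
Proof. by rewrite /bform trmx_mul !mulmxA. Qed.

Lemma bform_pull (R : comUnitRingType) m p (S : 'M[R]_m) (A : 'M[R]_(m, p)) u v :
  bform S (A *m u) (A *m v) = bform (A^T *m S *m A) u v.
Proof. by rewrite /bform trmx_mul !mulmxA. Qed.

Lemma trmx_mul_eq0 (R : comUnitRingType) p q (N : 'M[R]_(p, q)) :
  (forall (u : 'cV_p) (v : 'cV_q), (u^T *m (N *m v)) 0 0 = 0) -> N = 0.
Proof.
move=> hN; apply/matrixP => i j.
have := hN (delta_mx i 0) (delta_mx j 0).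
by rewrite trmx_delta -rowE mxE -colE !mxE.
Qed.

Lemma col_dual_eq0 (R : comUnitRingType) n (v : 'cV[R]_n) :
  (forall X : 'cV_n, (X^T *m v) 0 0 = 0) -> v = 0.
Proof.
move=> hv; apply/colP => i; rewrite [RHS]mxE -(hv (delta_mx i 0)).
by rewrite trmx_delta -rowE [RHS]mxE.
Qed.

Lemma mulmx_vec_inj (R : comUnitRingType) p q (N1 N2 : 'M[R]_(p, q)) :
  (forall v : 'cV_q, N1 *m v = N2 *m v) -> N1 = N2.
Proof.
move=> h; apply/matrixP => i j.
by have := congr1 (fun v : 'cV[R]_p => v i 0) (h (delta_mx j 0)); rewrite -!colE !mxE.
Qed.

Lemma posdef_unit (R : realFieldType) n (S : 'M[R]_n) :
  (forall X, X != 0 -> 0 < bform S X X) -> S \in unitmx.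
Proof.
move=> pos; rewrite unitmxE unitfE; apply/negP => /det0P[v v0 vS].
have := pos v^T; rewrite /bform trmxK vS mul0mx mxE ltxx => h.
by have: false by apply: h; rewrite trmx_eq0.
Qed.

(** * Commutative algebras with an invariant form *)

(** A commutative product [A X *m Y] on column vectors for which the form is
    invariant; it is what the second fundamental form of a horizontal immersion
    amounts to. *)
Section InvariantProduct.
Variables (R : realFieldType) (n : nat) (S : 'M[R]_n) (A : 'cV[R]_n -> 'M[R]_n).
Hypotheses (Ssym : S^T = S) (Sunit : S \in unitmx).
Hypothesis AC : forall X Y, A X *m Y = A Y *m X.
Hypothesis Ainv : forall X Y Z, bform S (A X *m Y) Z = bform S (A X *m Z) Y.

Lemma product_selfadjoint X Y Z : bform S (A X *m Y) Z = bform S Y (A X *m Z).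
Proof. by rewrite Ainv (bformC Ssym). Qed.

(** The Gauss equation of a constant curvature metric only concerns pairs of
    vectors; polarizing it twice gives back associativity, as for any tensor
    with the symmetries of a curvature tensor. *)
Lemma flat_product_assoc :
  (forall X Y, bform S (A X *m X) (A Y *m Y) = bform S (A X *m Y) (A X *m Y)) ->
  forall X Y (Z : 'cV_n), A X *m (A Y *m Z) = A (A X *m Y) *m Z.
Proof.
move=> flat.
pose q (X Y Z W : 'cV[R]_n) := bform S (A X *m Y) (A Z *m W).
have qC X Y Z W : q X Y Z W = q Y X Z W by rewrite /q AC.
have qS X Y Z W : q X Y Z W = q Z W X Y by rewrite /q (bformC Ssym).
have qC' X Y Z W : q X Y Z W = q X Y W Z by rewrite qS qC qS.
have qD1 X X' Y Z W : q (X + X') Y Z W = q X Y Z W + q X' Y Z W.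
  by rewrite /q AC mulmxDr !bformE -!(AC Y).
have qD2 X X' Y Z W : q Y (X + X') Z W = q Y X Z W + q Y X' Z W.
  by rewrite /q mulmxDr !bformE.
have qD3 X X' Y Z W : q Y Z (X + X') W = q Y Z X W + q Y Z X' W.
  by rewrite qS qD1 !(qS _ W).
have qD4 X X' Y Z W : q Y Z W (X + X') = q Y Z W X + q Y Z W X'.
  by rewrite /q mulmxDr !bformE.
have q0 X Y : q X X Y Y = q X Y X Y := flat X Y.
have q1 X Y W : q X W Y Y = q X Y W Y.
  have := q0 (X + W) Y; rewrite !(qD1, qD2, qD3).
  have := q0 X Y; have := q0 W Y; have := qC W X Y Y; have := qS W Y X Y.
  by lra.
have q2 X Y Z W : 2 * q X W Y Z = q X Y W Z + q X Z W Y.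
  have := q1 X (Y + Z) W; rewrite !(qD2, qD3, qD4).
  have := q1 X Y W; have := q1 X Z W; have := qC' X W Z Y.
  by lra.
have q3 X Y Z W : q X W Y Z = q X Y W Z.
  by have := q2 X Y Z W; have := q2 X W Z Y; have := qC' X Z Y W; lra.
move=> X Y Z; apply: (bform_eq Sunit) => W.
rewrite [A (A X *m Y) *m Z]AC -!(product_selfadjoint _ W).
by rewrite -/(q X W Y Z) -/(q Z W X Y) q3 [RHS]qS qC'.
Qed.

Hypothesis Anull : forall X, (forall Y : 'cV_n, A X *m Y = 0) -> X = 0.

(** The orthogonal complement of the products is the annihilator. *)
Lemma products_span p (L : 'M[R]_(p, n)) :
  (forall X (Y : 'cV_n), L *m (A X *m Y) = 0) -> L = 0.
Proof.
move=> hL; apply/row_matrixP => i; rewrite row0.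
set v := invmx S *m (row i L)^T.
have rowL : (S *m v)^T = row i L by rewrite /v mulKVmx // trmxK.
suff v0 : v = 0 by rewrite -rowL v0 mulmx0 trmx0.
apply: Anull => Y; apply: (bform_nondeg Sunit) => X.
rewrite AC -product_selfadjoint (bformC Ssym) /bform -{1}Ssym -trmx_mul rowL.
by rewrite -row_mul hL row0 mxE.
Qed.

(** An operator that can be moved across the product is a multiplier. *)
Lemma selfadjoint_multiplier (Phi : 'cV[R]_n -> 'cV[R]_n) :
  (forall X Y, bform S X (Phi Y) = bform S (Phi X) Y) ->
  (forall X (Y : 'cV_n), A X *m Phi Y = A Y *m Phi X) ->
  forall X Y, Phi (A X *m Y) = A X *m Phi Y.
Proof.
move=> Phisym PhiA X Y; apply: (bform_eq Sunit) => Z.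
rewrite Phisym (bformC Ssym) product_selfadjoint (PhiA X Z).
by rewrite -product_selfadjoint AC product_selfadjoint (PhiA Y X).
Qed.

(** Let a second invariant product, [At], be such that the multiplications of
    the first one can be moved across its cubic form.  Then
    X*(Y*(Z.W)) = (X.Y)*(Z*W) is symmetric in X and Y, so that the
    multiplications of the second product commute as well. *)
Lemma invariant_product_flat (St : 'M[R]_n) (At : 'cV[R]_n -> 'M[R]_n) :
  St^T = St -> St \in unitmx ->
  (forall X (Y : 'cV_n), At X *m Y = At Y *m X) ->
  (forall X Y Z, bform St (At X *m Y) Z = bform St (At X *m Z) Y) ->
  (forall X Y Z, bform St (A X *m Y) Z = bform St Y (A X *m Z)) ->
  (forall X Y Z W, bform St (At (A X *m W) *m Y) Z =
                   bform St (At X *m (A W *m Y)) Z) ->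
  forall X Y, bform St (At X *m X) (At Y *m Y) =
              bform St (At X *m Y) (At X *m Y).
Proof.
move=> Stsym Stunit AtC Atinv Asa move_mul X Y.
have Atsa X1 Y1 Z1 : bform St (At X1 *m Y1) Z1 = bform St Y1 (At X1 *m Z1).
  by rewrite Atinv (bformC Stsym).
have eqSt V1 V2 : (forall Z, bform St V1 Z = bform St V2 Z) -> V1 = V2.
  by move=> h; apply: (bform_eq Stunit) => Z; rewrite !(bformC Stsym Z).
have mulAtl W X1 (Y1 : 'cV_n) : At (A W *m X1) *m Y1 = At X1 *m (A W *m Y1).
  by apply: eqSt => Z; rewrite AC move_mul.
have mulAtr W X1 (Y1 : 'cV_n) : A W *m (At X1 *m Y1) = At X1 *m (A W *m Y1).
  by apply: eqSt => Z; rewrite Asa Atinv -mulAtl Atinv mulAtl.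
have comm_products X1 Y1 Z (W : 'cV_n) :
    At X1 *m (At Y1 *m (A Z *m W)) = At (A Y1 *m X1) *m (At Z *m W).
  by rewrite -(mulAtl Z Y1 W) AC mulAtl -mulAtr -mulAtl.
have comm : At X *m At Y = At Y *m At X.
  apply: subr0_eq; apply: products_span => Z W.
  by rewrite mulmxBl -!mulmxA !comm_products [A Y *m X]AC subrr.
by rewrite Atsa mulmxA comm -mulmxA -Atsa AtC.
Qed.

End InvariantProduct.

(** * The pseudo-Hermitian space *)

Section AmbientAlgebra.
Variables (R : realType) (n : nat) (eps c : R).
Hypothesis heps : eps = 1 \/ eps = -1.
Local Notation G := (gramC n eps).
Local Notation J := (Jmx R n).

Lemma gramC_tr : G^T = G.
Proof. exact: tr_diag_mx. Qed.

Lemma gramC_unit : G \in unitmx.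
Proof.
rewrite unitmxE det_diag unitfE; apply/prodf_neq0 => i _.
have eps0 : eps != 0 by case: heps => ->; rewrite ?oppr_eq0 oner_eq0.
rewrite mxE; case: splitP => j _; rewrite !mxE; case: ifP => _ //; exact: oner_neq0.
Qed.

Lemma Jmx_tr : J^T = - J.
Proof. by rewrite /Jmx tr_block_mx opp_block_mx !trmx0 linearN /= !trmx1 !oppr0 opprK. Qed.

Lemma Jmx_sqr : J *m J = - 1%:M.
Proof.
rewrite /Jmx mulmx_block !mul0mx !mulmx0 !mulNmx !mulmxN !mul1mx !addr0 !add0r.
by rewrite [in RHS]scalar_mx_block opp_block_mx oppr0.
Qed.

Lemma Jmx_gramC : J *m G = G *m J.
Proof.
by rewrite /Jmx /gramC diag_mx_row !mulmx_block !mul0mx !mulmx0 !mulNmx !mulmxN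
  !mul1mx !mulmx1 !addr0 !add0r.
Qed.

Lemma Jmx_skew : J^T *m G = - (G *m J).
Proof. by rewrite Jmx_tr mulNmx Jmx_gramC. Qed.

Lemma Jmx_isometry : J^T *m G *m J = G.
Proof. by rewrite Jmx_skew mulNmx -mulmxA Jmx_sqr mulmxN opprK mulmx1. Qed.

Lemma inner_Jmx u v : bform G (J *m u) (J *m v) = bform G u v.
Proof. by rewrite bform_pull Jmx_isometry. Qed.

Lemma inner_Jmxl u v : bform G (J *m u) v = - bform G u (J *m v).
Proof.
rewrite bform_mull Jmx_skew /bform mulNmx mulmxN mxE; congr (- _).
by rewrite -!mulmxA.
Qed.

Lemma inner_Jmx_self u : bform G (J *m u) u = 0.
Proof.
by have := inner_Jmxl u u; rewrite [X in - X](bformC gramC_tr); lra.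
Qed.

Lemma gram_Jmxl p q (B1 : 'M[R]_(Cdim n, p)) (B2 : 'M[R]_(Cdim n, q)) :
  (J *m B1)^T *m G *m B2 = - (B1^T *m G *m J *m B2).
Proof. by rewrite trmx_mul -(mulmxA _ J^T) Jmx_skew mulmxN mulNmx !mulmxA. Qed.

Lemma gram_Jmx p q (B1 : 'M[R]_(Cdim n, p)) (B2 : 'M[R]_(Cdim n, q)) :
  (J *m B1)^T *m G *m (J *m B2) = B1^T *m G *m B2.
Proof.
rewrite gram_Jmxl mulmxA -(mulmxA _ J J) Jmx_sqr.
by rewrite mulmxN mulmx1 mulNmx opprK.
Qed.

Lemma gram_tr p q (B1 : 'M[R]_(Cdim n, p)) (B2 : 'M[R]_(Cdim n, q)) :
  (B1^T *m G *m B2)^T = B2^T *m G *m B1.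
Proof. by rewrite !trmx_mul trmxK gramC_tr mulmxA. Qed.

Lemma gram_row_mx p q r s (A : 'M[R]_(Cdim n, p)) (B : 'M[R]_(Cdim n, q))
    (C : 'M[R]_(Cdim n, r)) (D : 'M[R]_(Cdim n, s)) :
  (row_mx A B)^T *m G *m row_mx C D =
  block_mx (A^T *m G *m C) (A^T *m G *m D) (B^T *m G *m C) (B^T *m G *m D).
Proof. by rewrite tr_row_mx mul_col_mx mul_col_row. Qed.

(** The tangent space of a horizontal immersion, its image under the complex
    structure, the position vector and the Hopf direction exhaust the ambient
    space by dimension. *)
Lemma horizontal_frame_complete (B : 'M[R]_(Cdim n, n)) (z w : 'cV[R]_(Cdim n)) :
  c != 0 -> B^T *m G *m B \in unitmx -> B^T *m G *m J *m B = 0 ->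
  B^T *m G *m z = 0 -> B^T *m G *m J *m z = 0 -> bform G z z = c^-1 ->
  B^T *m G *m w = 0 -> B^T *m G *m J *m w = 0 ->
  bform G z w = 0 -> bform G (J *m z) w = 0 -> w = 0.
Proof.
move=> c0 uB BJB Bz BJz zz Bw Bw' zw Jzw.
pose S := row_mx (row_mx B (J *m B)) (row_mx z (J *m z)).
have zGz : z^T *m G *m z = (c^-1)%:M by rewrite [LHS]mx11_scalar -[_ 0 0]/(bform G z z) zz.
have zGJz : z^T *m G *m J *m z = 0.
  rewrite [LHS]mx11_scalar -!mulmxA mulmxA -[_ 0 0]/(bform G z (J *m z)).
  by rewrite (bformC gramC_tr) inner_Jmx_self raddf0.
have zB : z^T *m G *m B = 0 by rewrite -gram_tr Bz trmx0.
have JzB : (J *m z)^T *m G *m B = 0 by rewrite -gram_tr mulmxA BJz trmx0.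
have zJB : z^T *m G *m (J *m B) = 0.
  by rewrite mulmxA -[LHS]opprK -gram_Jmxl JzB oppr0.
have SGS : S^T *m G *m S =
   block_mx (block_mx (B^T *m G *m B) 0 0 (B^T *m G *m B)) 0
            0 (block_mx (c^-1)%:M 0 0 (c^-1)%:M).
  have S12 : (row_mx B (J *m B))^T *m G *m row_mx z (J *m z) = 0.
    rewrite gram_row_mx gram_Jmx gram_Jmxl Bz mulmxA BJz.
    by rewrite oppr0 block_mx0.
  have S21 : (row_mx z (J *m z))^T *m G *m row_mx B (J *m B) = 0.
    by rewrite -gram_tr S12 trmx0.
  rewrite /S gram_row_mx S12 S21.
  rewrite !gram_row_mx !gram_Jmx !gram_Jmxl !mulmxA BJB zGJz zGz.
  by rewrite !oppr0.
have uS : S^T *m G *m S \in unitmx.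
  rewrite SGS unitmxE !det_ublock !unitrM -!unitmxE uB /=.
  by rewrite !unitmxE !det_scalar unitrX ?unitfE ?invr_eq0.
have fS : row_free S.
  rewrite /row_free eqn_leq rank_leq_row.
  apply: leq_trans (mxrankM_maxr (S^T *m G) S).
  by rewrite mxrank_unit // addnACA !addn1.
have wS : (G *m w)^T *m S = 0.
  rewrite trmx_mul gramC_tr; apply: trmx_inj.
  have gram_row p q (B1 : 'M[R]_(Cdim n, p)) (B2 : 'M[R]_(Cdim n, q)) :
      (row_mx B1 B2)^T *m G *m w = col_mx (B1^T *m G *m w) (B2^T *m G *m w).
    by rewrite tr_row_mx !mul_col_mx.
  rewrite gram_tr trmx0 /S !gram_row Bw gram_Jmxl Bw'.
  have e1 (v : 'cV[R]_(Cdim n)) : bform G v w = 0 -> v^T *m G *m w = 0.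
    by move=> vw; rewrite [LHS]mx11_scalar -[_ 0 0]/(bform G v w) vw raddf0.
  by rewrite (e1 z zw) (e1 _ Jzw) oppr0 !col_mx0.
have Gw0 : (G *m w)^T = 0 by apply/eqP; rewrite -(mulmx_free_eq0 _ fS) wS.
by rewrite -[w](mulKmx gramC_unit) -[G *m w]trmxK Gw0 trmx0 mulmx0.
Qed.

End AmbientAlgebra.

(** * The Gauss equation of an induced metric *)

(** Koszul's formula for a Gram matrix B^T G B: as the second derivatives are
    symmetric, four of its six terms cancel in pairs and the other two agree. *)
Lemma christoffel_algebra (R : numFieldType) N n (G : 'M[R]_N) (B : 'M[R]_(N, n))
    (dB : 'cV[R]_n -> 'M[R]_(N, n)) (X Y : 'cV[R]_n) : G^T = G ->
  (forall X (Y : 'cV_n), dB X *m Y = dB Y *m X) ->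
  ((dB X)^T *m G *m B + B^T *m G *m dB X) *m Y +
  ((dB Y)^T *m G *m B + B^T *m G *m dB Y) *m X -
  \col_l (X^T *m ((dB (delta_mx l 0))^T *m G *m B +
                   B^T *m G *m dB (delta_mx l 0)) *m Y) 0 0
  = 2 *: (B^T *m G *m (dB X *m Y)).
Proof.
move=> Gsym dBC; apply/colP => l.
have colD (u v : 'cV[R]_n) : (u + v) l 0 = u l 0 + v l 0 by rewrite mxE.
have colN (u : 'cV[R]_n) : (- u) l 0 = - u l 0 by rewrite mxE.
have ent (A C : 'M[R]_(N, n)) (Z : 'cV_n) :
    (A^T *m G *m C *m Z) l 0 = bform G (A *m delta_mx l 0) (C *m Z).
  by rewrite /bform trmx_mul trmx_delta -!mulmxA -rowE [RHS]mxE.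
have ent2 (A C : 'M[R]_(N, n)) (Z Z' : 'cV_n) :
    (Z^T *m (A^T *m G *m C) *m Z') 0 0 = bform G (A *m Z) (C *m Z').
  by rewrite /bform trmx_mul !mulmxA.
have colE (f : 'I_n -> R) : (\col_i f i) l 0 = f l by rewrite mxE.
have colZ (a : R) (u : 'cV[R]_n) : (a *: u) l 0 = a * u l 0 by rewrite mxE.
rewrite !mulmxDl !colD colN colE colZ mulmxDr mulmxDl [in RHS]mulmxA.
have entD (u v : 'M[R]_1) : (u + v) 0 0 = u 0 0 + v 0 0 by rewrite mxE.
rewrite entD.
rewrite !ent !ent2 (dBC (delta_mx l 0) X) (dBC (delta_mx l 0) Y) (dBC Y X).
by rewrite (bformC Gsym (B *m X)); ring.
Qed.

Section GaussEquation.
Variables (R : realType) (n : nat) (M : topologicalType) (eps : R).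
Variables (e : chart R n M) (U : set M) (g : metric R n M).
Variable H : M -> 'cV[R]_(Cdim n).
Hypotheses (oU : open U) (sH : smooth_on e U H).
Hypothesis gE : forall x, cdom e x -> U x -> g e x = induced_metric eps H e x.
Hypothesis gU : forall x, cdom e x -> U x -> g e x \in unitmx.
Local Notation G := (gramC n eps).
Local Notation B := (dmx e H).
Local Notation b X Y := (fun x => dd e X (dmx e H) x *m Y).

(** This and flat_sff are taken with respect to the flat ambient space instead
    of the quadric, because the ambient third derivatives commute. *)
Definition flat_connection (X Y : 'cV[R]_n) (x : M) : 'cV[R]_n :=
  invmx (g e x) *m (B x)^T *m G *m (dd e X B x *m Y).

Definition flat_sff (X Y : 'cV[R]_n) (x : M) : 'cV[R]_(Cdim n) :=
  dd e X B x *m Y - B x *m flat_connection X Y x.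

Let sB : smooth_on e U B := smooth_on_dmx oU sH.

Lemma smooth_on_gram p q (h1 : M -> 'M[R]_(Cdim n, p)) (h2 : M -> 'M[R]_(Cdim n, q)) :
  smooth_on e U h1 -> smooth_on e U h2 ->
  smooth_on e U (fun x => (h1 x)^T *m G *m h2 x).
Proof.
move=> s1 s2; apply: smooth_on_mulmx => //.
by apply: smooth_on_mulcst => //; exact: smooth_on_tr.
Qed.

Lemma dd_gram p q (h1 : M -> 'M[R]_(Cdim n, p)) (h2 : M -> 'M[R]_(Cdim n, q)) X x :
  smooth_on e U h1 -> smooth_on e U h2 -> cdom e x -> U x ->
  dd e X (fun y => (h1 y)^T *m G *m h2 y) x =
  (dd e X h1 x)^T *m G *m h2 x + (h1 x)^T *m G *m dd e X h2 x.
Proof.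
move=> s1 s2 ex Ux; have s1t := smooth_on_tr oU s1.
rewrite (dd_mulmx _ (smooth_on_mulcst oU G s1t) s2 ex Ux).
by rewrite (dd_mulmxr _ _ s1t ex Ux) (dd_tr _ s1 ex Ux).
Qed.

Let sg : smooth_on e U (g e).
Proof.
apply: (smooth_on_ext oU) (smooth_on_gram sB sB).
by move=> x ex Ux; rewrite gE.
Qed.

Lemma smooth_flat_connection X Y : smooth_on e U (flat_connection X Y).
Proof.
apply: smooth_on_mulmx => //; last first.
  by apply: smooth_on_mulcst => //; exact: smooth_on_dd.
apply: smooth_on_mulcst => //; apply: smooth_on_mulmx => //.
  exact: smooth_on_invmx.
exact: smooth_on_tr.
Qed.

Lemma dd_induced_metric X x : cdom e x -> U x ->
  dd e X (g e) x = (dd e X B x)^T *m G *m B x + (B x)^T *m G *m dd e X B x.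
Proof.
move=> ex Ux; rewrite -(dd_gram X sB sB ex Ux).
by apply: (dd_ext oU) => // y ey Uy; rewrite gE.
Qed.

Lemma christoffel_induced X Y x : cdom e x -> U x ->
  christoffel g e X Y x = flat_connection X Y x.
Proof.
move=> ex Ux; rewrite /christoffel /flat_connection.
have dBC X1 Y1 := dd_dmxC oU X1 Y1 sH ex Ux.
rewrite !(dd_induced_metric _ ex Ux).
under eq_mx do rewrite (dd_induced_metric _ ex Ux).
rewrite (christoffel_algebra (B x) X Y (gramC_tr n eps) dBC).
by rewrite -scalemxAr scalerA mulVf ?pnatr_eq0 // scale1r !mulmxA.
Qed.

Lemma flat_sff_orthogonal X Y x : cdom e x -> U x ->
  (B x)^T *m G *m flat_sff X Y x = 0.
Proof.
move=> ex Ux; rewrite /flat_sff /flat_connection mulmxBr !mulmxA.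
rewrite -/(induced_metric eps H e x) -gE // mulmxV; last exact: gU.
by rewrite mul1mx subrr.
Qed.

Lemma metric_flat_connection X V x : cdom e x -> U x ->
  g e x *m flat_connection X V x = (B x)^T *m G *m (dd e X B x *m V).
Proof.
move=> ex Ux; rewrite /flat_connection; move: (dd e X B x *m V) => w.
by rewrite !mulmxA mulmxV ?mul1mx //; exact: gU.
Qed.

(** Lowering the index turns the outer covariant derivative into an ambient one;
    flat_sff being normal, its tangential derivative is traded for one of B. *)
Lemma metric_nabla X Y Z x : cdom e x -> U x ->
  g e x *m nabla g e X (nabla g e Y (fun=> Z)) x =
  (B x)^T *m G *m dd e X (fun y => dd e Y B y *m Z) x +
  (dd e X B x)^T *m G *m flat_sff Y Z x.
Proof.
move=> ex Ux; have sW := smooth_flat_connection Y Z.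
have W_nabla y : cdom e y -> U y -> nabla g e Y (fun=> Z) y = flat_connection Y Z y.
  by move=> ey Uy; rewrite /nabla dd_cst add0r christoffel_induced.
have sdB : smooth_on e U (fun y => dd e Y B y *m Z).
  by apply: smooth_on_mulcst => //; exact: smooth_on_dd.
have sBW : smooth_on e U (fun y => B y *m flat_connection Y Z y).
  exact: smooth_on_mulmx.
have sT : smooth_on e U (flat_sff Y Z) by exact: smooth_onB.
rewrite {1}/nabla (dd_ext oU X W_nabla ex Ux) W_nabla // christoffel_induced //.
set V := flat_connection Y Z x.
have -> : g e x *m (dd e X (flat_connection Y Z) x + flat_connection X V x) =
    (B x)^T *m G *m dd e X (fun y => B y *m flat_connection Y Z y) x.
  rewrite (dd_mulmx _ sB sW ex Ux) mulmxDr [RHS]mulmxDr addrC; congr (_ + _).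
    exact: metric_flat_connection.
  rewrite gE // /induced_metric.
  by move: (dd e X _ x) (B x) => w B0; rewrite !mulmxA.
have dT : dd e X (flat_sff Y Z) x = dd e X (fun y => dd e Y B y *m Z) x -
    dd e X (fun y => B y *m flat_connection Y Z y) x.
  exact (ddB oU X sdB sBW ex Ux).
have : dd e X (fun y => (B y)^T *m G *m flat_sff Y Z y) x = 0.
  rewrite -(dd_cst e 0 X x); apply: (dd_ext oU) => // y ey Uy.
  exact: flat_sff_orthogonal.
rewrite (dd_gram X sB sT ex Ux) dT.
move: (flat_sff Y Z x) (dd e X (fun _ => _) x) => t q; rewrite mulmxBr addrA.
by move=> /eqP; rewrite subr_eq0 addrC => /eqP.
Qed.

(** Antisymmetrizing metric_nabla in X and Y cancels the third derivatives. *)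
Theorem gauss_equation X Y Z V x : cdom e x -> U x ->
  gin g e x (riem g e X Y Z x) V =
  bform G (flat_sff X V x) (flat_sff Y Z x) -
  bform G (flat_sff Y V x) (flat_sff X Z x).
Proof.
move=> ex Ux.
have gsym : (g e x)^T = g e x by rewrite gE // /induced_metric gram_tr.
rewrite -[gin _ _ _ _ _]/(bform (g e x) (riem g e X Y Z x) V) (bformC gsym).
have pair X1 Y1 : bform G (dd e X1 B x *m V) (flat_sff Y1 Z x) =
    bform G (flat_sff X1 V x) (flat_sff Y1 Z x).
  rewrite -[flat_sff X1 V x]/(dd e X1 B x *m V - B x *m flat_connection X1 V x).
  rewrite bformBl [bform G (B x *m _) _]bform_mull.
  by rewrite (flat_sff_orthogonal Y1 Z ex Ux) mulmx0 [_ 0 0]mxE subr0.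
have sdB Y1 : smooth_on e U (dd e Y1 B) by exact: smooth_on_dd.
have comm : dd e X (fun y => dd e Y B y *m Z) x = dd e Y (fun y => dd e X B y *m Z) x.
  rewrite (dd_mulmxr Z X (sdB Y) ex Ux) (dd_mulmxr Z Y (sdB X) ex Ux).
  exact (congr1 (mulmx^~ Z) (dd_symmetric oU X Y sB ex Ux)).
have expand r : bform (g e x) V r = (V^T *m (g e x *m r)) 0 0.
  by rewrite /bform mulmxA.
have e1 := metric_nabla X Y Z ex Ux; have e2 := metric_nabla Y X Z ex Ux.
apply: (etrans _ (congr2 (fun s t => s - t) (pair X Y) (pair Y X))).
rewrite /riem; move: (nabla g e X _ x) (nabla g e Y _ x) comm e1 e2 => r1 r2.
move: (dd e X (fun _ => _ *m _) x) (dd e Y (fun _ => _ *m _) x) => t' t.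
move: (dd e X B x) (dd e Y B x) (flat_sff Y Z x) (flat_sff X Z x).
move=> bX bY tY tX -> e1 e2; rewrite bformBr !expand e1 e2 !bform_mull !mulmxDr.
have entD (u v : 'M[R]_1) : (u + v) 0 0 = u 0 0 + v 0 0 by rewrite mxE.
by rewrite !entD; ring.
Qed.

End GaussEquation.

(** * Horizontal maps into the quadric *)

(** Linear algebra at a point of a horizontal map: B is the differential, z the
    position vector and db X *m Y the second derivative along X and Y. *)
Section HorizontalPoint.
Variables (R : realType) (n : nat) (eps c : R).
Hypotheses (heps : eps = 1 \/ eps = -1) (c0 : c != 0).
Local Notation G := (gramC n eps).
Local Notation J := (Jmx R n).
Variables (B : 'M[R]_(Cdim n, n)) (z : 'cV[R]_(Cdim n)).
Variables (db : 'cV[R]_n -> 'M[R]_(Cdim n, n)) (g : 'M[R]_n).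
Hypotheses (gE : g = B^T *m G *m B) (gU : g \in unitmx).
Hypothesis zz : bform G z z = c^-1.
Hypothesis Bz : B^T *m G *m z = 0.
Hypothesis BJz : B^T *m G *m (J *m z) = 0.
Hypothesis BJB : B^T *m G *m (J *m B) = 0.
Hypothesis dbC : forall X (Y : 'cV_n), db X *m Y = db Y *m X.
Hypothesis db_z : forall X Y, bform G (db X *m Y) z = - bform g X Y.
Hypothesis db_Jz : forall X Y, bform G (db X *m Y) (J *m z) = 0.
Hypothesis db_cubic : forall X Y Z,
  bform G (db X *m Y) (J *m (B *m Z)) = bform G (db X *m Z) (J *m (B *m Y)).

(** The product X.Y dual to the cubic form <d_X d_Y f, J f_* Z>. *)
Definition cubic_product (X : 'cV[R]_n) : 'M[R]_n :=
  invmx g *m ((J *m B)^T *m G *m db X).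

(** What flat_sff amounts to at the point. *)
Definition point_sff (X Y : 'cV[R]_n) : 'cV[R]_(Cdim n) :=
  db X *m Y - B *m (invmx g *m B^T *m G *m (db X *m Y)).

Let gsym : g^T = g. Proof. by rewrite gE gram_tr. Qed.

Lemma cubic_productE X Y Z :
  bform g Z (cubic_product X *m Y) = bform G (J *m (B *m Z)) (db X *m Y).
Proof.
rewrite (mulmxA J) bform_mull /bform -(mulmxA _ g); congr ((_ *m _) 0 0).
by rewrite /cubic_product !mulmxA mulmxV // mul1mx.
Qed.

Lemma cubic_productC X Y : cubic_product X *m Y = cubic_product Y *m X.
Proof. by rewrite /cubic_product -!mulmxA dbC. Qed.

Lemma cubic_product_invariant X Y Z :
  bform g (cubic_product X *m Y) Z = bform g (cubic_product X *m Z) Y.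
Proof.
rewrite !(bformC gsym (cubic_product X *m _)) !cubic_productE.
by rewrite !(bformC (gramC_tr n eps) (J *m _)) db_cubic.
Qed.

Let bB0 v X : B^T *m G *m v = 0 -> bform G (B *m X) v = 0.
Proof. by move=> Bv; rewrite bform_mull Bv mulmx0 mxE. Qed.

Let bB0' v X : B^T *m G *m v = 0 -> bform G v (B *m X) = 0.
Proof. by move=> Bv; rewrite (bformC (gramC_tr n eps)) bB0. Qed.

Let JBB X Y : bform G (J *m (B *m X)) (B *m Y) = 0.
Proof.
by rewrite inner_Jmxl [J *m _]mulmxA bform_mull [B^T *m _ *m _]mulmxA BJB
  mul0mx mulmx0 mxE oppr0.
Qed.

(** Both sides have the same products with the frame f_* T, J f_* T, z, J z. *)
Lemma point_sff_horizontal X Y :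
  point_sff X Y = J *m (B *m (cubic_product X *m Y)) - (c * bform g X Y) *: z.
Proof.
apply: subr0_eq; set w := (X in X = 0).
have uB : B^T *m G *m B \in unitmx by rewrite -gE.
have symG := bformC (gramC_tr n eps).
have JzB Z : bform G (J *m z) (B *m Z) = 0 by rewrite symG bB0.
have JBz Z : bform G (J *m (B *m Z)) z = 0.
  by rewrite inner_Jmxl bB0 // oppr0.
have Bw : B^T *m G *m w = 0.
  rewrite /w !mulmxBr -scalemxAr Bz scaler0 subr0 (mulmxA J) (mulmxA _ (J *m B)).
  rewrite BJB mul0mx subr0 (mulmxA _ B) -gE !mulmxA mulmxV // mul1mx.
  by rewrite -!mulmxA subrr.
have JBw Z : bform G (J *m (B *m Z)) w = 0.
  rewrite /w /point_sff !bformBr bformZr JBz JBB inner_Jmx bform_pull -gE.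
  by rewrite cubic_productE; ring.
apply: (horizontal_frame_complete heps c0 uB) zz Bw _ _ _ => //.
- by rewrite -mulmxA.
- by rewrite -mulmxA.
- apply/colP => i; rewrite [RHS]mxE.
  have := JBw (delta_mx i 0); rewrite inner_Jmxl => /eqP; rewrite oppr_eq0 => /eqP.
  by rewrite bform_mull trmx_delta -rowE mxE mulmxA.
- have zb : bform G z (db X *m Y) = - bform g X Y by rewrite symG db_z.
  have zJB V : bform G z (J *m (B *m V)) = 0 by rewrite symG JBz.
  by rewrite /w /point_sff !bformBr bformZr zz zJB bB0' // zb; field.
- have Jzb : bform G (J *m z) (db X *m Y) = 0 by rewrite symG db_Jz.
  rewrite /w /point_sff !bformBr bformZr JzB inner_Jmx bB0' // Jzb.
  by rewrite inner_Jmx_self; ring.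
Qed.

Lemma point_sff_inner X Y Z W :
  bform G (point_sff X Y) (point_sff Z W) =
  bform g (cubic_product X *m Y) (cubic_product Z *m W) +
  c * bform g X Y * bform g Z W.
Proof.
have symG := bformC (gramC_tr n eps).
have JBz V : bform G (J *m (B *m V)) z = 0.
  by rewrite inner_Jmxl bB0 // oppr0.
rewrite !point_sff_horizontal !(bformBl, bformBr) !(bformZl, bformZr).
rewrite inner_Jmx bform_pull -gE zz (symG z) !JBz.
by field.
Qed.

End HorizontalPoint.

Lemma curvature_algebra (R : comUnitRingType) n (g : 'M[R]_n)
    (A : 'cV[R]_n -> 'M[R]_n) c X Y : g^T = g -> A Y *m X = A X *m Y ->
  bform g (A X *m X) (A Y *m Y) + c * bform g X X * bform g Y Y -
  (bform g (A Y *m X) (A X *m Y) + c * bform g Y X * bform g X Y) =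
  bform g (A X *m X) (A Y *m Y) - bform g (A X *m Y) (A X *m Y) +
  c * (bform g X X * bform g Y Y - bform g X Y ^+ 2).
Proof. by move=> gsym ->; rewrite (bformC gsym Y X); ring. Qed.

Section HorizontalMap.
Variables (R : realType) (n : nat) (M : topologicalType) (eps c : R).
Hypotheses (heps : eps = 1 \/ eps = -1) (c0 : c != 0).
Variables (e : chart R n M) (U : set M).
Variable H : M -> 'cV[R]_(Cdim n).
Hypotheses (oU : open U) (sH : smooth_on e U H).
Local Notation G := (gramC n eps).
Local Notation J := (Jmx R n).
Local Notation B := (dmx e H).
Hypothesis quad : forall x, cdom e x -> U x -> bform G (H x) (H x) = c^-1.
Hypothesis hor : forall x X, cdom e x -> U x ->
  bform G (J *m H x) (dd e X H x) = 0.

Let sB : smooth_on e U B := smooth_on_dmx oU sH.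
Let symG := bformC (gramC_tr n eps).

Lemma dd_gram_cst p q (h1 : M -> 'M[R]_(Cdim n, p)) (h2 : M -> 'M[R]_(Cdim n, q))
    (C : 'M[R]_(p, q)) X x :
  smooth_on e U h1 -> smooth_on e U h2 ->
  (forall y, cdom e y -> U y -> (h1 y)^T *m G *m h2 y = C) ->
  cdom e x -> U x ->
  (dd e X h1 x)^T *m G *m h2 x + (h1 x)^T *m G *m dd e X h2 x = 0.
Proof.
move=> s1 s2 hC ex Ux; have E1 := dd_gram eps oU X s1 s2 ex Ux.
have E2 := dd_ext oU X hC ex Ux.
exact (etrans (esym E1) (etrans E2 (dd_cst e C X x))).
Qed.

Lemma position_normal x : cdom e x -> U x -> (B x)^T *m G *m H x = 0.
Proof.
move=> ex Ux; apply: col_dual_eq0 => X.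
have quadM y : cdom e y -> U y -> (H y)^T *m G *m H y = (c^-1)%:M.
  by move=> ey Uy; rewrite [LHS]mx11_scalar -[_ 0 0]/(bform G (H y) (H y)) quad.
have := congr1 (fun N : 'M[R]_1 => N 0 0) (dd_gram_cst X sH sH quadM ex Ux).
rewrite -(dmxE X sH ex Ux) -bform_mull; move: (B x) => B0.
rewrite mxE -[X in X + _]/(bform G (B0 *m X) (H x)).
rewrite -[X in _ + X]/(bform G (H x) (B0 *m X)) (symG (H x)) [RHS]mxE; lra.
Qed.

Lemma hopf_normal x : cdom e x -> U x -> (B x)^T *m G *m (J *m H x) = 0.
Proof.
move=> ex Ux; apply: col_dual_eq0 => X.
have := hor X ex Ux; rewrite -(dmxE X sH ex Ux) symG.
by rewrite bform_mull.
Qed.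

Lemma second_derivative_symmetric x : cdom e x -> U x ->
  forall X (Y : 'cV_n), dd e X B x *m Y = dd e Y B x *m X.
Proof. by move=> ex Ux X Y; exact: (dd_dmxC oU X Y sH ex Ux). Qed.

Let entry p q (N1 : 'M[R]_(Cdim n, p)) (N2 : 'M[R]_(Cdim n, q))
    (N3 : 'M[R]_(Cdim n, p)) (N4 : 'M[R]_(Cdim n, q)) (Y : 'cV_p) (Z : 'cV_q) :
  N1^T *m G *m N2 + N3^T *m G *m N4 = 0 ->
  bform G (N1 *m Y) (N2 *m Z) + bform G (N3 *m Y) (N4 *m Z) = 0.
Proof.
move=> h; rewrite !bform_mull; have <- : (Y^T *m 0 *m Z) 0 0 = 0 :> R.
  by rewrite mulmx0 mul0mx mxE.
have entD (u v : 'M[R]_1) : (u + v) 0 0 = u 0 0 + v 0 0 by rewrite mxE.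
by rewrite -h mulmxDr mulmxDl entD !mulmxA.
Qed.

Lemma second_derivative_position x X Y : cdom e x -> U x ->
  bform G (dd e X B x *m Y) (H x) = - bform G (B x *m X) (B x *m Y).
Proof.
move=> ex Ux; have := dd_gram_cst X sB sH position_normal ex Ux.
rewrite -(dmxE X sH ex Ux); move: (dd e X _ x) (B x) => b0 B0.
move=> /(entry Y 1%:M); rewrite !mulmx1 (symG (B0 *m X)).
by move=> /eqP; rewrite addr_eq0 => /eqP.
Qed.

Let sJH : smooth_on e U (fun x => J *m H x) := smooth_on_cstmul oU J sH.
Let sJB : smooth_on e U (fun x => J *m B x) := smooth_on_cstmul oU J sB.

Let dJH x X Y : cdom e x -> U x ->
  bform G (dd e X B x *m Y) (J *m H x) + bform G (B x *m Y) (J *m (B x *m X)) = 0.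
Proof.
move=> ex Ux; have := dd_gram_cst X sB sJH hopf_normal ex Ux.
rewrite (dd_mulmxl J X sH ex Ux) -(dmxE X sH ex Ux).
move: (dd e X _ x) (B x) => b0 B0.
by move=> /(entry Y 1%:M); rewrite !mulmx1.
Qed.

(** Differentiating horizontality gives a quantity that is both symmetric
    (second derivatives commute) and skew (the complex structure is skew). *)
Lemma isotropic x : cdom e x -> U x -> (B x)^T *m G *m (J *m B x) = 0.
Proof.
move=> ex Ux; apply: trmx_mul_eq0 => X Y.
have h1 := dJH Y X ex Ux; have h2 := dJH X Y ex Ux.
have e1 := congr1 (fun v => bform G v (J *m H x))
  (second_derivative_symmetric ex Ux X Y).
move: h1 h2 e1; move: (dd e X _ x) (dd e Y _ x) (B x) => bX bY B0 h1 h2 e1.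
have := inner_Jmxl eps (B0 *m X) (B0 *m Y); rewrite symG.
have -> : (X^T *m (B0^T *m G *m (J *m B0) *m Y)) 0 0 =
    bform G (B0 *m X) (J *m (B0 *m Y)) by rewrite bform_mull !mulmxA.
by move: h1 h2 e1; lra.
Qed.

Lemma second_derivative_hopf x X Y : cdom e x -> U x ->
  bform G (dd e X B x *m Y) (J *m H x) = 0.
Proof.
move=> ex Ux; have := dJH X Y ex Ux; rewrite (mulmxA J) [X in _ + X]bform_mull.
by rewrite (mulmxA _ (J *m _)) isotropic // mul0mx mulmx0 [X in _ + X]mxE addr0.
Qed.

Lemma second_derivative_cubic x X Y Z : cdom e x -> U x ->
  bform G (dd e X B x *m Y) (J *m (B x *m Z)) =
  bform G (dd e X B x *m Z) (J *m (B x *m Y)).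
Proof.
move=> ex Ux; have := dd_gram_cst X sB sJB isotropic ex Ux.
rewrite (dd_mulmxl J X sB ex Ux); move: (dd e X _ x) (B x) => b0 B0.
move=> /(entry Y Z); rewrite -!mulmxA => /eqP; rewrite addr_eq0 => /eqP ->.
by rewrite -inner_Jmxl symG.
Qed.

Variable g : metric R n M.
Hypothesis gE : forall x, cdom e x -> U x -> g e x = induced_metric eps H e x.
Hypothesis gU : forall x, cdom e x -> U x -> g e x \in unitmx.

Definition sff_product (x : M) : 'cV[R]_n -> 'M[R]_n :=
  cubic_product eps (B x) (fun X => dd e X B x) (g e x).

Lemma sff_productC x X Y : cdom e x -> U x ->
  sff_product x X *m Y = sff_product x Y *m X.
Proof. by move=> ex Ux; apply: cubic_productC; exact: second_derivative_symmetric. Qed.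

Lemma sff_product_invariant x X Y Z : cdom e x -> U x ->
  bform (g e x) (sff_product x X *m Y) Z = bform (g e x) (sff_product x X *m Z) Y.
Proof.
move=> ex Ux; apply: cubic_product_invariant; [exact: gE|exact: gU|].
by move=> *; exact: second_derivative_cubic.
Qed.

Lemma sff_productE x X Y Z : cdom e x -> U x ->
  bform (g e x) Z (sff_product x X *m Y) =
  bform G (J *m (B x *m Z)) (dd e X B x *m Y).
Proof. by move=> ex Ux; apply: cubic_productE; exact: gU. Qed.

Lemma flat_sff_horizontal x X Y : cdom e x -> U x ->
  flat_sff eps e g H X Y x =
  J *m (B x *m (sff_product x X *m Y)) - (c * bform (g e x) X Y) *: H x.
Proof.
move=> ex Ux.
apply: (@point_sff_horizontal R n eps c heps c0 (B x) (H x)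
  (fun X => dd e X B x) (g e x)); [exact: gE|exact: gU|exact: quad|
  exact: position_normal|exact: hopf_normal|exact: isotropic|..].
- by move=> X1 Y1; rewrite gE // -bform_pull; exact: second_derivative_position.
- by move=> X1 Y1; exact: second_derivative_hopf.
Qed.

Lemma flat_sff_inner x X Y Z W : cdom e x -> U x ->
  bform G (flat_sff eps e g H X Y x) (flat_sff eps e g H Z W x) =
  bform (g e x) (sff_product x X *m Y) (sff_product x Z *m W) +
  c * bform (g e x) X Y * bform (g e x) Z W.
Proof.
move=> ex Ux.
apply: (@point_sff_inner R n eps c heps c0 (B x) (H x)
  (fun X => dd e X B x) (g e x)); [exact: gE|exact: gU|exact: quad|
  exact: position_normal|exact: hopf_normal|exact: isotropic|..].
- by move=> X1 Y1; rewrite gE // -bform_pull; exact: second_derivative_position.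
- by move=> X1 Y1; exact: second_derivative_hopf.
Qed.

Lemma horizontal_curvature x X Y : cdom e x -> U x ->
  gin g e x (riem g e X Y Y x) X =
  bform (g e x) (sff_product x X *m X) (sff_product x Y *m Y) -
  bform (g e x) (sff_product x X *m Y) (sff_product x X *m Y) +
  c * (gin g e x X X * gin g e x Y Y - gin g e x X Y ^+ 2).
Proof.
move=> ex Ux.
have gsym : (g e x)^T = g e x by rewrite gE // /induced_metric gram_tr.
apply: (etrans (gauss_equation oU sH gE gU X Y Y X ex Ux)).
apply: (etrans (congr2 (fun s t => s - t) (flat_sff_inner X X Y Y ex Ux)
                                          (flat_sff_inner Y X X Y ex Ux))).
exact (curvature_algebra c gsym (sff_productC Y X ex Ux)).
Qed.

Lemma sff_cubic x X Y : cdom e x -> U x ->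
  sff eps c g H e X Y x = J *m (B x *m (sff_product x X *m Y)).
Proof.
move=> ex Ux.
pose N b := normal_part eps g H e x (quadric_proj eps c (H x) b).
apply: (etrans (congr1 N (dd_dd_dmx oU X Y sH ex Ux))).
have gXY : bform G (B x *m X) (B x *m Y) = bform (g e x) X Y.
  by rewrite bform_pull gE.
have := second_derivative_position X Y ex Ux.
rewrite gXY symG => Hb.
have flatE := flat_sff_horizontal X Y ex Ux.
rewrite /N /normal_part /tangent_part /quadric_proj.
rewrite -[inner _ _ _]/(bform G (H x) (dd e X B x *m Y)) Hb.
rewrite mulrN scaleNr opprK mulmxDr -scalemxAr.
have -> : invmx (g e x) *m (B x)^T *m G *m H x = 0.
  by rewrite -2!(mulmxA (invmx _)) position_normal // mulmx0.
rewrite scaler0 addr0.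
rewrite addrAC; apply: (etrans (congr1 (fun u => u + _) flatE)).
by rewrite subrK.
Qed.

End HorizontalMap.

(** * Algebra of the Ribaucour transformation at a point *)

Section RibaucourPoint.
Variables (R : realType) (n k : nat) (eps c : R).
Hypotheses (c0 : c != 0).
Local Notation G := (gramC n eps).
Local Notation J := (Jmx R n).
Variables (B : 'M[R]_(Cdim n, n)) (z : 'cV[R]_(Cdim n)).
Variables (phi : 'cV[R]_k) (omega : 'M[R]_(k, n)) (omegat : 'M[R]_(n, k)).
Variables (Gm beta : 'M[R]_(Cdim n, k)) (Om : 'M[R]_k) (g : 'M[R]_n).
Hypotheses (gE : g = B^T *m G *m B) (gU : g \in unitmx).
Hypothesis omegatE : omegat = invmx g *m omega^T.
Hypothesis GmE : Gm = B *m omegat + beta + c *: (z *m phi^T).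
Hypothesis zz : z^T *m G *m z = (c^-1)%:M.
Hypothesis Bz : B^T *m G *m z = 0.
Hypothesis Bbeta : B^T *m G *m beta = 0.
Hypothesis zbeta : z^T *m G *m beta = 0.
Hypothesis OmU : Om \in unitmx.
Hypothesis OmS : Om + Om^T = Gm^T *m G *m Gm.

(** The isometry of the ambient space that takes f to its transform; it plays the
    part of the reflection of the scalar Ribaucour transformation. *)
Definition ribaucour_op : 'M[R]_(Cdim n) := 1%:M - Gm *m invmx Om *m (Gm^T *m G).
Local Notation Q := ribaucour_op.

Let gsym : g^T = g. Proof. by rewrite gE gram_tr. Qed.

Lemma omegat_tr : omegat^T = omega *m invmx g.
Proof. by rewrite omegatE trmx_mul trmxK trmx_inv gsym. Qed.

Let zB : z^T *m G *m B = 0. Proof. by rewrite -gram_tr Bz trmx0. Qed.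
Let betaB : beta^T *m G *m B = 0. Proof. by rewrite -gram_tr Bbeta trmx0. Qed.
Let betaz : beta^T *m G *m z = 0. Proof. by rewrite -gram_tr zbeta trmx0. Qed.

Let GmT : Gm^T = omegat^T *m B^T + beta^T + c *: (phi *m z^T).
Proof. by rewrite GmE !linearD linearZ /= !trmx_mul trmxK. Qed.

Lemma Gm_tangent : Gm^T *m G *m B = omega.
Proof.
rewrite GmT !mulmxDl -!scalemxAl betaB addr0 -(mulmxA phi) -(mulmxA phi) zB.
rewrite mulmx0 scaler0 addr0 -2!(mulmxA omegat^T) -gE.
by rewrite omegat_tr mulmxKV.
Qed.

Lemma Gm_position : Gm^T *m G *m z = phi.
Proof.
rewrite GmT !mulmxDl -!scalemxAl betaz addr0 -2!(mulmxA phi) zz.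
rewrite -2!(mulmxA omegat^T) Bz mulmx0 add0r mul_mx_scalar scalerA.
by rewrite mulfV // scale1r.
Qed.

Lemma ribaucour_op_position : Q *m z = z - Gm *m invmx Om *m phi.
Proof. by rewrite /Q mulmxBl mul1mx -(mulmxA (Gm *m _)) Gm_position. Qed.

Lemma ribaucour_op_Gm : Gm^T *m G *m Q = - (Om^T *m invmx Om *m (Gm^T *m G)).
Proof.
rewrite /Q mulmxBr mulmx1 2!(mulmxA (Gm^T *m G)) -OmS mulmxDl mulmxV //.
by rewrite mulmxDl mul1mx opprD addNKr.
Qed.

(** The symmetric part of Om is half the Gram matrix of Gm, which makes the
    operator an isometry, as for a reflection. *)
Lemma ribaucour_op_isometry : Q^T *m G *m Q = G.
Proof.
have QT : Q^T = 1%:M - G *m Gm *m (invmx Om)^T *m Gm^T.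
  rewrite /Q [LHS]linearB /= trmx1 !trmx_mul trmxK gramC_tr.
  by rewrite -!mulmxA.
have OmTU : Om^T \in unitmx by rewrite unitmx_tr.
rewrite QT mulmxBl mul1mx mulmxBl -(mulmxA _ Gm^T) -(mulmxA _ (Gm^T *m G)).
rewrite ribaucour_op_Gm mulmxN opprK (mulmxA _ (Om^T *m _)) (mulmxA _ Om^T).
rewrite trmx_inv (mulmxKV OmTU) /Q mulmxBr mulmx1 !mulmxA.
by rewrite subrK.
Qed.

Lemma bform_ribaucour_op u v : bform G (Q *m u) (Q *m v) = bform G u v.
Proof. by rewrite bform_pull ribaucour_op_isometry. Qed.

(** The second derivative of the transform paired with Q xi, for xi normal to
    the original map; dGm and dQ stand for derivatives of Gm and Q in one
    direction. *)
Lemma transformed_second_derivative (kap : 'M[R]_(n, k)) (dGm : 'M[R]_(Cdim n, k))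
    (dQ : 'M[R]_(Cdim n)) (xi w : 'cV[R]_(Cdim n)) (d s : 'cV[R]_n) :
  dGm = B *m kap ->
  dQ = - (Q *m dGm *m invmx Om *m (Gm^T *m G)) -
       Gm *m invmx Om *m (dGm^T *m G) ->
  B^T *m G *m xi = 0 ->
  bform G (dQ *m (B *m d) + Q *m (w + B *m s)) (Q *m xi) =
  bform G w xi + bform g d (kap *m (invmx Om *m (Gm^T *m G *m xi))).
Proof.
move=> dGmE dQE Bxi.
have Bxi0 v : bform G (B *m v) xi = 0 by rewrite bform_mull Bxi mulmx0 mxE.
rewrite bformDl bform_ribaucour_op bformDl Bxi0 addr0 addrC; congr (_ + _).
rewrite dQE mulmxBl mulNmx bformBl bformNl.
set u := B *m d; set v := invmx Om *m (Gm^T *m G *m u).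
have -> : Q *m dGm *m invmx Om *m (Gm^T *m G) *m u = Q *m (B *m (kap *m v)).
  by rewrite dGmE /v !mulmxA.
rewrite bform_ribaucour_op Bxi0 oppr0 sub0r.
set t := dGm^T *m G *m u; set r := Gm^T *m G *m xi.
have -> : Gm *m invmx Om *m (dGm^T *m G) *m u = Gm *m (invmx Om *m t).
  by rewrite /t !mulmxA.
rewrite bform_mull (mulmxA _ Q) ribaucour_op_Gm mulNmx mulmxN.
rewrite (_ : forall u : 'M[R]_1, (- u) 0 0 = - u 0 0); last by move=> ?; rewrite mxE.
rewrite opprK.
have -> : Om^T *m invmx Om *m (Gm^T *m G) *m xi = Om^T *m (invmx Om *m r).
  by rewrite /r !mulmxA.
rewrite trmx_mul -mulmxA (mulmxA _ Om^T).
rewrite -trmx_mul mulmxV // trmx1 mul1mx /t dGmE gE -bform_pull /u.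
by rewrite gram_tr /bform !mulmxA.
Qed.

(** For a P-transform Gm = S + J S P with S = f_* omega^t + c f phi^t.  Since
    S^t J S = 0 and S^t S = N, all the products of Gm and J Gm are expressed by
    N and P. *)
Variable P : 'M[R]_k.
Hypothesis PU : P \in unitmx.
Hypothesis BJz : B^T *m G *m (J *m z) = 0.
Hypothesis BJB : B^T *m G *m (J *m B) = 0.
Variables (S : 'M[R]_(Cdim n, k)) (N : 'M[R]_k).
Hypothesis SE : S = B *m omegat + c *: (z *m phi^T).
Hypothesis betaE : beta = J *m S *m P.
Hypothesis NE : N = omega *m omegat + c *: (phi *m phi^T).
Hypothesis OmP : Om^T *m P + P^T *m Om^T +
  (- P^T - invmx P^T) *m (P^T *m N *m P) = 0.

Let zJz : z^T *m G *m (J *m z) = 0.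
Proof.
rewrite [LHS]mx11_scalar -[_ 0 0]/(bform G z (J *m z)).
by rewrite (bformC (gramC_tr n eps)) inner_Jmx_self raddf0.
Qed.
Let zJB : z^T *m G *m (J *m B) = 0.
Proof. by rewrite -gram_tr gram_Jmxl -mulmxA BJz oppr0 trmx0. Qed.

Let ST : S^T = omegat^T *m B^T + c *: (phi *m z^T).
Proof. by rewrite SE linearD linearZ /= !trmx_mul trmxK. Qed.

Let SB : S^T *m G *m B = omega.
Proof. by rewrite -Gm_tangent GmT ST !mulmxDl betaB addr0. Qed.
Let Sz : S^T *m G *m z = phi.
Proof. by rewrite -[RHS]Gm_position GmT ST !mulmxDl betaz addr0. Qed.
Let SJB : S^T *m G *m (J *m B) = 0.
Proof.
rewrite ST !mulmxDl -!scalemxAl -2!(mulmxA omegat^T) BJB.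
by rewrite -2!(mulmxA phi) zJB !mulmx0 scaler0 addr0.
Qed.
Let SJz : S^T *m G *m (J *m z) = 0.
Proof.
rewrite ST !mulmxDl -!scalemxAl -2!(mulmxA omegat^T) BJz.
by rewrite -2!(mulmxA phi) zJz !mulmx0 scaler0 addr0.
Qed.
Let SS : S^T *m G *m S = N.
Proof.
rewrite {2}SE mulmxDr -scalemxAr !mulmxA SB.
by rewrite Sz NE.
Qed.
Let SJS : S^T *m G *m (J *m S) = 0.
Proof.
rewrite {2}SE (mulmxDr J) -scalemxAr !(mulmxA J) mulmxDr -scalemxAr.
by rewrite (mulmxA _ (J *m B)) (mulmxA _ (J *m z)) SJB SJz !mul0mx scaler0 addr0.
Qed.
Let GmS : Gm = S + J *m S *m P.
Proof. by rewrite GmE betaE [in RHS]SE addrAC -SE. Qed.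
Let GmST : Gm^T = S^T + P^T *m (J *m S)^T.
Proof. by rewrite GmS linearD /= (trmx_mul _ P). Qed.

Let OmN : Om + Om^T = N + P^T *m N *m P.
Proof.
rewrite OmS GmST GmS !mulmxDl !mulmxDr !(mulmxA _ (J *m S) P) SJS mul0mx addr0 SS.
rewrite -2!(mulmxA P^T) gram_Jmxl -(mulmxA _ J) SJS oppr0 mulmx0 add0r.
by rewrite -2!(mulmxA P^T) gram_Jmx SS mulmxA.
Qed.

Let GmJGm : Gm^T *m G *m (J *m Gm) = P^T *m N - N *m P.
Proof.
have JJS : J *m (J *m S *m P) = - (S *m P).
  by rewrite !mulmxA Jmx_sqr !mulNmx mul1mx.
have JSS : (J *m S)^T *m G *m S = 0 by rewrite gram_Jmxl -(mulmxA _ J) SJS oppr0.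
rewrite GmST GmS mulmxDr JJS !mulmxDl !mulmxDr SJS add0r !mulmxN.
rewrite !(mulmxA _ S P) SS -(mulmxA P^T _ G) -!(mulmxA P^T (_ *m G)).
by rewrite gram_Jmx SS JSS mulmx0 mul0mx oppr0 addr0 addrC.
Qed.

Let GmJB : Gm^T *m G *m (J *m B) = P^T *m omega.
Proof.
by rewrite GmST !mulmxDl SJB add0r -2!(mulmxA P^T) gram_Jmx SB.
Qed.

Let zJGm : z^T *m G *m (J *m Gm) = - (phi^T *m P).
Proof.
apply: trmx_inj; rewrite gram_tr gram_Jmxl -(mulmxA _ J) GmST !mulmxDl SJz add0r.
by rewrite -2!(mulmxA P^T) gram_Jmx Sz linearN /= trmx_mul trmxK.
Qed.

(** The obstruction to horizontality is this expression, multiplied by Om^-t phi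
    on one side and Om^-1 omega on the other.  It vanishes by the condition on Om
    once Om is replaced by N + P^t N P - Om^t. *)
Lemma P_condition : Om^T *m P - P^T *m Om + P^T *m N - N *m P = 0.
Proof.
have PTU : P^T \in unitmx by rewrite unitmx_tr.
have OmE : Om = N + P^T *m N *m P - Om^T by rewrite -OmN addrK.
have h : Om^T *m P + P^T *m Om^T =
    P^T *m (P^T *m N *m P) + N *m P.
  apply/eqP; rewrite -subr_eq0 -[X in _ == X]OmP; apply/eqP; congr (_ + _).
  rewrite mulmxDl !mulNmx opprD; congr (_ - _).
  by rewrite -!mulmxA mulKmx.
have hb : P^T *m Om = P^T *m N + P^T *m (P^T *m N *m P) - P^T *m Om^T.
  by rewrite {1}OmE mulmxBr mulmxDr.
have -> : Om^T *m P = N *m P + P^T *m (P^T *m N *m P) - P^T *m Om^T.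
  by rewrite (addrC (N *m P)) -h addrK.
rewrite hb opprB subrKA (addrC (P^T *m N) (P^T *m _)) addrKA.
by rewrite subrK subrr.
Qed.

Lemma ribaucour_horizontal_at : (Q *m z)^T *m G *m (J *m (Q *m B)) = 0.
Proof.
have OmTU : Om^T \in unitmx by rewrite unitmx_tr.
have QB : Q *m B = B - Gm *m (invmx Om *m omega).
  by rewrite /Q mulmxBl mul1mx -(mulmxA _ _ B) Gm_tangent !mulmxA.
have QzT : (Q *m z)^T = z^T - phi^T *m (invmx Om)^T *m Gm^T.
  by rewrite ribaucour_op_position linearB /= !trmx_mul mulmxA.
set r := invmx Om *m omega in QB; set a := phi^T *m (invmx Om)^T in QzT.
have phiE : phi^T = a *m Om^T by rewrite /a -mulmxA -trmx_mul mulmxV // trmx1 mulmx1.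
have omE : omega = Om *m r by rewrite /r mulKVmx.
clearbody a r.
rewrite QB QzT mulmxBr (mulmxA J) !mulmxBl !mulmxBr zJB.
rewrite -!(mulmxA a) GmJB (mulmxA _ (J *m Gm)) (mulmxA _ (J *m Gm)) zJGm GmJGm.
rewrite phiE omE sub0r mulNmx opprK -!mulmxA -mulmxBr.
have cond := congr1 (fun K => a *m (K *m r)) P_condition.
rewrite mul0mx mulmx0 in cond; rewrite -[RHS]cond -mulmxBr; congr (a *m _).
rewrite !(mulmxA _ _ r) -!mulmxBl; congr (_ *m r).
by rewrite opprD opprK !addrA.
Qed.

End RibaucourPoint.

(** * The Ribaucour transformation in a chart *)

Lemma tangential_components (R : comUnitRingType) m n (S : 'M[R]_m) (B : 'M[R]_(m, n))
    (g : 'M[R]_n) (p : 'cV[R]_m) (t : 'cV[R]_n) : g = B^T *m S *m B -> g \in unitmx ->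
  p = B *m t -> p = B *m (invmx g *m B^T *m S *m p).
Proof.
move=> gE gU pE; rewrite {1}pE; congr (_ *m _).
have : g *m t = B^T *m S *m p by rewrite gE pE mulmxA.
by move=> /(congr1 (mulmx (invmx g))); rewrite mulKmx // !mulmxA.
Qed.

Lemma calG_derivative_algebra (R : comUnitRingType) N n k (c : R)
    (B : 'M[R]_(N, n)) (z : 'cV[R]_N) (bX : 'M[R]_(N, n)) (bt : 'M[R]_(N, k))
    (wt dwt : 'M[R]_(n, k)) (phi dphi : 'cV[R]_k) (X t1 t2 : 'cV[R]_n) v a1 a2 :
  bX *m (wt *m v) - (c * a1) *: z - B *m t1 +
    (bt *m v - (c * a2) *: z - B *m t2) = 0 ->
  a1 + a2 = - (dphi^T *m v) 0 0 ->
  (bX *m wt + B *m dwt + bt + c *: (B *m X *m phi^T + z *m dphi^T)) *m v =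
  B *m (t1 + t2 + dwt *m v + (c * (phi^T *m v) 0 0) *: X).
Proof.
move=> h ha.
have vec1 (u : 'cV[R]_N) (s : 'cV[R]_k) : u *m s^T *m v = (s^T *m v) 0 0 *: u.
  by rewrite -mulmxA [X in u *m X]mx11_scalar mul_mx_scalar.
rewrite !mulmxDl -scalemxAl mulmxDl !vec1 !mulmxDr -scalemxAr -!mulmxA.
have hs : (dphi^T *m v) 0 0 = - (a1 + a2) by rewrite ha opprK.
apply: subr0_eq; rewrite -[RHS]h hs; apply/colP => i; rewrite !mxE; ring.
Qed.

Lemma integrability_algebra (R : comUnitRingType) N n k (S : 'M[R]_N)
    (B bX bY : 'M[R]_(N, n)) (kX kY a b : 'M[R]_(n, k)) xi v :
  B^T *m S *m xi = 0 -> bY *m kX + B *m a = bX *m kY + B *m b ->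
  bform S (bY *m (kX *m v)) xi = bform S (bX *m (kY *m v)) xi.
Proof.
move=> Bxi h.
have B0 u : bform S (B *m u) xi = 0 by rewrite bform_mull Bxi mulmx0 mxE.
have := congr1 (fun K => bform S (K *m v) xi) h.
by rewrite /= !mulmxDl -!mulmxA !bformDl !B0 !addr0.
Qed.

Section RibaucourChart.
Variables (R : realType) (n k : nat) (M : topologicalType) (eps c : R).
Hypotheses (heps : eps = 1 \/ eps = -1) (c0 : c != 0).
Variables (A : set (chart R n M)) (g : metric R n M).
Variables (F : M -> 'cV[R]_(Cdim n)).
Variables (phi : M -> 'cV[R]_k) (beta : M -> 'M[R]_(Cdim n, k)).
Variable Omega : M -> 'M[R]_k.
Hypothesis hg : riemannian_metric A setT g.
Hypothesis hF : isometric_immersion eps c A setT g F.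
Hypothesis hor : forall e x X, A e -> cdom e x ->
  bform (gramC n eps) (Jmx R n *m F x) (dd e X F x) = 0.
Hypothesis hR : ribaucour_data eps c A g F phi beta Omega.
Variable e : chart R n M.
Hypothesis Ae : A e.
Local Notation G := (gramC n eps).
Local Notation J := (Jmx R n).
Local Notation B := (dmx e F).
Local Notation Gm := (calG c g F phi beta e).
Local Notation smooth := (smooth_on e setT).
Let I x : [set: M] x := Logic.I.
Let oT : open [set: M] := openT.
Let symG := bformC (gramC_tr n eps).

Let sF : smooth F := ii_smooth hF Ae.
Let sphi : smooth phi := rd_phi_smooth hR Ae.
Let sbeta : smooth beta := rd_beta_smooth hR Ae.
Let sOm : smooth Omega := rd_Omega_smooth hR Ae.
Let sB : smooth B := smooth_on_dmx oT sF.

Lemma metric_induced x : cdom e x -> [set: M] x -> g e x = induced_metric eps F e x.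
Proof. by move=> ex _; rewrite -(ii_isometric hF). Qed.

Lemma metric_unit x : cdom e x -> [set: M] x -> g e x \in unitmx.
Proof.
move=> ex _; apply: posdef_unit => X X0.
exact: (rm_pos hg Ae ex (I x) X0).
Qed.

Lemma metric_symmetric x : cdom e x -> (g e x)^T = g e x.
Proof. by move=> ex; exact: (rm_sym hg Ae ex (I x)). Qed.

Lemma quadric_norm x : cdom e x -> [set: M] x -> bform G (F x) (F x) = c^-1.
Proof. by move=> _ _; exact: (ii_quadric hF). Qed.

Let hor' x X : cdom e x -> [set: M] x -> bform G (J *m F x) (dd e X F x) = 0.
Proof. by move=> ex _; exact: hor. Qed.

Let swt : smooth (omega_t g phi e).
Proof.
apply: smooth_on_mulmx => //; first apply: smooth_on_invmx => //.
- exact: metric_unit.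
- exact: (rm_smooth hg Ae).
- by apply: smooth_on_tr => //; exact: smooth_on_dmx.
Qed.

Lemma smooth_calG : smooth Gm.
Proof.
apply: smooth_onD => //; first apply: smooth_onD => //.
  exact: smooth_on_mulmx.
apply: smooth_onZ => //; apply: smooth_on_mulmx => //; exact: smooth_on_tr.
Qed.
Let sGm := smooth_calG.

Let sK X : smooth (dd e X Gm).
Proof. exact: smooth_on_dd. Qed.

(** The derivative of Gm along X maps v to f_* Phi_v X; it is convenient to read
    Phi_v X off this derivative instead of the covariant derivatives defining
    it. *)
Definition Phi_mx (X : 'cV[R]_n) (x : M) : 'M[R]_(n, k) :=
  invmx (g e x) *m (B x)^T *m G *m dd e X Gm x.

Let sPhi_mx X : smooth (Phi_mx X).
Proof.
apply: smooth_on_mulmx => //; apply: smooth_on_mulcst => //.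
apply: smooth_on_mulmx => //; last exact: smooth_on_tr.
apply: smooth_on_invmx => //; first exact: metric_unit.
exact: (rm_smooth hg Ae).
Qed.

Lemma dd_calG X x : cdom e x ->
  dd e X Gm x = dd e X B x *m omega_t g phi e x + B x *m dd e X (omega_t g phi e) x
  + dd e X beta x + c *: (dd e X F x *m (phi x)^T + F x *m (dd e X phi x)^T).
Proof.
move=> ex; have Ix := I x.
have s1 : smooth (fun y => B y *m omega_t g phi e y) by exact: smooth_on_mulmx.
have s2t : smooth (fun y => (phi y)^T) by exact: smooth_on_tr.
have s2 : smooth (fun y => F y *m (phi y)^T) by exact: smooth_on_mulmx.
have s3 := smooth_onZ oT c s2.
have s12 := smooth_onD oT s1 sbeta.
rewrite [LHS](ddD X s12 s3 ex Ix) (ddD X s1 sbeta ex Ix).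
rewrite (dd_mulmx X sB swt ex Ix) (ddZ oT c X s2 ex Ix).
by rewrite (dd_mulmx X sF s2t ex Ix) (dd_tr X sphi ex Ix).
Qed.

Lemma beta_position x : cdom e x -> (F x)^T *m G *m beta x = 0.
Proof.
move=> ex; apply: trmx_mul_eq0 => u v.
have h0 : (F x)^T *m G *m (beta x *m v) = 0.
  rewrite [LHS]mx11_scalar -[_ 0 0]/(inner eps (F x) (beta x *m v)).
  by rewrite (rd_beta_quadric hR) raddf0.
by rewrite -(mulmxA _ (beta x)) h0 mulmx0 mxE.
Qed.

Lemma beta_tangent x : cdom e x -> (B x)^T *m G *m beta x = 0.
Proof.
move=> ex; apply: trmx_mul_eq0 => X v.
have := rd_beta_normal hR X v Ae ex; rewrite -(dmxE X sF ex (I x)).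
rewrite -[inner _ _ _]/(bform G (B x *m X) (beta x *m v)) bform_mull.
by rewrite !mulmxA.
Qed.

Lemma dd_beta_position X v x : cdom e x ->
  bform G (F x) (dd e X beta x *m v) = 0.
Proof.
move=> ex.
have h y : cdom e y -> [set: M] y -> (F y)^T *m G *m beta y = 0.
  by move=> ey _; exact: beta_position.
have := dd_gram_cst oT X sF sbeta h ex (I x).
rewrite -(dmxE X sF ex (I x)); move: (beta_tangent ex).
move: (dd e X beta x) (B x) => b B0 Bb.
rewrite trmx_mul -(mulmxA X^T) -(mulmxA X^T) Bb mulmx0 add0r => h0.
by rewrite /bform mulmxA h0 mul0mx mxE.
Qed.

(** The compatibility condition on beta says that Gm has no normal derivative;
    the terms along the position vector cancel by themselves. *)
Lemma dd_calG_tangent X x : cdom e x -> dd e X Gm x = B x *m Phi_mx X x.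
Proof.
move=> ex; have Ix := I x.
apply: mulmx_vec_inj => v; set w := omega_t g phi e x *m v.
have Fp : bform G (F x) (dd e X B x *m w + dd e X beta x *m v) =
    - ((dd e X phi x)^T *m v) 0 0.
  rewrite bformDr dd_beta_position // addr0 symG.
  apply: (etrans (second_derivative_position oT sF quadric_norm X w ex Ix)).
  rewrite bform_pull -[X in bform X]/(induced_metric eps F e x).
  rewrite -metric_induced // -(dmxE X sphi ex Ix) /w /omega_t /bform.
  by rewrite !trmx_mul -!mulmxA mulKVmx ?metric_unit.
have E1 : dd e X (dd e w F) x = dd e X B x *m w := dd_dd_dmx oT X w sF ex Ix.
have E2 : dd e X (fun y => beta y *m v) x = dd e X beta x *m v :=
  dd_mulmxr v X sbeta ex Ix.
pose T q := tangent_part eps g F e x (quadric_proj eps c (F x) q).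
pose N q := normal_part eps g F e x (quadric_proj eps c (F x) q).
have NE q : N q = q - (c * bform G (F x) q) *: F x - B x *m T q by [].
have N0 : N (dd e X B x *m w) + N (dd e X beta x *m v) = 0 :=
  etrans (congr2 (fun s t => N s + N t) (esym E1) (esym E2)) (rd_beta hR X v Ae ex).
rewrite (NE (_ *m w)) (NE (_ *m v)) in N0.
rewrite /w in N0.
have tang := tangential_components (metric_induced ex Ix) (metric_unit ex Ix).
apply: (etrans (tang _ _ (etrans (congr1 (mulmx^~ v) (dd_calG X ex)) _))).
  rewrite -(dmxE X sF ex Ix).
  apply: (calG_derivative_algebra (dd e X (omega_t g phi e) x) (phi x) X N0).
  by rewrite -bformDr -/w Fp.
rewrite /Phi_mx; move: (invmx _) (dd e X Gm x) => g' K.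
by rewrite !mulmxA.
Qed.

Let Bz x (ex : cdom e x) := position_normal oT sF quadric_norm ex (I x).
Let BJB x (ex : cdom e x) := isotropic oT sF hor' ex (I x).

(** The second derivatives of Gm commute; the terms tangent to f drop out.  The
    choice of the position vector for xi gives the symmetry of Phi_v, and that of
    J f_* Z gives alpha(Y, Phi_v X) = alpha(X, Phi_v Y). *)
Lemma Phi_mx_integrable X Y v xi x : cdom e x -> (B x)^T *m G *m xi = 0 ->
  bform G (dd e Y B x *m (Phi_mx X x *m v)) xi =
  bform G (dd e X B x *m (Phi_mx Y x *m v)) xi.
Proof.
move=> ex Bxi; have Ix := I x.
have ddG X1 Y1 : dd e Y1 (dd e X1 Gm) x =
    dd e Y1 B x *m Phi_mx X1 x + B x *m dd e Y1 (Phi_mx X1) x.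
  apply: (etrans (dd_ext oT Y1 (h2 := fun y => B y *m Phi_mx X1 y) _ ex Ix)).
    by move=> y ey _; exact: dd_calG_tangent.
  exact: (dd_mulmx Y1 sB (sPhi_mx X1) ex Ix).
apply: (integrability_algebra v Bxi).
exact (etrans (esym (ddG X Y)) (etrans (dd_symmetric oT Y X sGm ex Ix) (ddG Y X))).
Qed.

Lemma Phi_mx_symmetric X Y v x : cdom e x ->
  bform (g e x) Y (Phi_mx X x *m v) = bform (g e x) X (Phi_mx Y x *m v).
Proof.
move=> ex; have := Phi_mx_integrable X Y v ex (Bz ex).
have pos := second_derivative_position oT sF quadric_norm.
have e1 := pos x Y (Phi_mx X x *m v) ex (I x).
have e2 := pos x X (Phi_mx Y x *m v) ex (I x).
have gp u w : bform G (B x *m u) (B x *m w) = bform (g e x) u w.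
  by rewrite bform_pull metric_induced.
move=> h; have h' := oppr_inj (etrans (esym e1) (etrans h e2)).
exact (etrans (esym (gp _ _)) (etrans h' (gp _ _))).
Qed.

Local Notation Ap := (sff_product eps e F g).

Lemma Phi_mx_sff_product X Y (v : 'cV[R]_k) x : cdom e x ->
  Ap x Y *m (Phi_mx X x *m v) = Ap x X *m (Phi_mx Y x *m v).
Proof.
move=> ex; apply: (bform_eq (metric_unit ex (I x))) => Z.
have BJBZ : (B x)^T *m G *m (J *m (B x *m Z)) = 0.
  by rewrite (mulmxA J) mulmxA BJB // mul0mx.
have pE := sff_productE eps F metric_unit.
apply: (etrans (pE x Y (Phi_mx X x *m v) Z ex (I x))).
apply: (etrans _ (esym (pE x X (Phi_mx Y x *m v) Z ex (I x)))).
apply: (etrans (symG _ _)); apply: (etrans _ (symG _ _)).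
exact: Phi_mx_integrable.
Qed.

(** Hence the shape operators of f commute with Phi_v. *)
Lemma Phi_mx_multiplier X Y (v : 'cV[R]_k) x : cdom e x ->
  Phi_mx (Ap x X *m Y) x *m v = Ap x X *m (Phi_mx Y x *m v).
Proof.
move=> ex.
apply: (selfadjoint_multiplier (A := Ap x) (metric_symmetric ex)
  (metric_unit ex (I x)) _ _ (Phi := fun X => Phi_mx X x *m v)).
- by move=> X1 Y1; exact (sff_productC eps oT sF g X1 Y1 ex (I x)).
- move=> X1 Y1 Z1; exact (sff_product_invariant oT sF hor' metric_induced
    metric_unit X1 Y1 Z1 ex (I x)).
- move=> X1 Y1; rewrite (bformC (metric_symmetric ex) (Phi_mx X1 x *m v)).
  exact: Phi_mx_symmetric.
- by move=> X1 Y1; exact: Phi_mx_sff_product.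
Qed.

Local Notation Q := (fun y => ribaucour_op eps (Gm y) (Omega y)).

Let uOm x : cdom e x -> [set: M] x -> Omega x \in unitmx.
Proof. by move=> _ _; exact: (rd_Omega_unit hR). Qed.

Let siOm : smooth (fun y => invmx (Omega y)) := smooth_on_invmx oT uOm sOm.

Lemma smooth_ribaucour_op : smooth Q.
Proof.
apply: smooth_onB => //; first exact: smooth_on_cst.
apply: smooth_on_mulmx => //; first exact: smooth_on_mulmx.
by apply: smooth_on_mulcst => //; exact: smooth_on_tr.
Qed.
Let sQ := smooth_ribaucour_op.

(** As d Omega = Gm^t d Gm, the derivative of the inverse of Omega completes the
    derivative of the first factor Gm to Q d Gm. *)
Lemma dd_ribaucour_op X x : cdom e x ->
  dd e X Q x =
  - (Q x *m dd e X Gm x *m invmx (Omega x) *m ((Gm x)^T *m G)) -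
  Gm x *m invmx (Omega x) *m ((dd e X Gm x)^T *m G).
Proof.
move=> ex; have Ix := I x.
have s1 : smooth (fun=> 1%:M : 'M[R]_(Cdim n)) by exact: smooth_on_cst.
have s2 : smooth (fun y => Gm y *m invmx (Omega y)) by exact: smooth_on_mulmx.
have s3t : smooth (fun y => (Gm y)^T) by exact: smooth_on_tr.
have s3 : smooth (fun y => (Gm y)^T *m G) by exact: smooth_on_mulcst.
have s4 : smooth (fun y => Gm y *m invmx (Omega y) *m ((Gm y)^T *m G)).
  exact: smooth_on_mulmx.
rewrite [LHS](ddB oT X s1 s4 ex Ix) dd_cst (dd_mulmx X s2 s3 ex Ix).
rewrite (dd_mulmx X sGm siOm ex Ix) (dd_mulmxr G X s3t ex Ix) (dd_tr X sGm ex Ix).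
rewrite (dd_invmx X oT sOm uOm ex Ix) (rd_Omega_diff hR X Ae ex) /adjC /ribaucour_op.
move: (dd e X Gm x) (Gm x) (invmx _) => K Gm0 Oi.
rewrite sub0r opprD mulmxDl; congr (_ - _); congr (- _).
by rewrite !(mulmxBl, mulmxN, mulNmx) mul1mx !mulmxA.
Qed.

Definition Omega_phi (x : M) : 'cV[R]_k := invmx (Omega x) *m phi x.

(** The endomorphism D = 1 - Phi_(Omega^-1 phi) of the tangent spaces for which
    d f~ = Q f_* D. *)
Definition tangent_factor (x : M) : 'M[R]_n :=
  1%:M - invmx (g e x) *m (B x)^T *m G *m dmx e (fun y => Gm y *m Omega_phi x) x.

Lemma tangent_factorE X x : cdom e x -> tangent_factor x *m X = X - Phi_mx X x *m Omega_phi x.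
Proof.
move=> ex; have sGa : smooth (fun y => Gm y *m Omega_phi x) by exact: smooth_on_mulcst.
rewrite /tangent_factor mulmxBl mul1mx -[_ *m dmx _ _ _ *m X]mulmxA (dmxE X sGa ex (I x)).
by rewrite (dd_mulmxr _ X sGm ex (I x)) /Phi_mx !mulmxA.
Qed.

Let zz x : cdom e x -> (F x)^T *m G *m F x = (c^-1)%:M.
Proof.
by move=> ex; rewrite [LHS]mx11_scalar -[_ 0 0]/(bform G (F x) (F x)) quadric_norm.
Qed.

Variable Ft : M -> 'cV[R]_(Cdim n).
Hypothesis FtE : forall x, cdom e x ->
  Ft x = F x - Gm x *m invmx (Omega x) *m phi x.

Lemma transform_op x : cdom e x -> Ft x = Q x *m F x.
Proof.
move=> ex; rewrite FtE //.
by rewrite (ribaucour_op_position c0 (Omega x) (erefl (Gm x)) (zz ex) (Bz ex)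
  (beta_position ex)).
Qed.

Lemma smooth_transform : smooth Ft.
Proof.
apply: (smooth_on_ext oT (h1 := fun x => Q x *m F x)).
  by move=> x ex _; rewrite transform_op.
exact: smooth_on_mulmx.
Qed.
Let sFt := smooth_transform.

Lemma dd_transform X x : cdom e x ->
  dd e X Ft x = Q x *m (B x *m (X - Phi_mx X x *m Omega_phi x)).
Proof.
move=> ex; have Ix := I x.
have h y : cdom e y -> [set: M] y -> Ft y = Q y *m F y.
  by move=> ey _; exact: transform_op.
apply: (etrans (dd_ext oT X h ex Ix)).
apply: (etrans (dd_mulmx X sQ sF ex Ix)).
rewrite (dd_ribaucour_op X ex) -(dmxE X sF ex Ix) (dd_calG_tangent X ex).
have GmF : (Gm x)^T *m G *m F x = phi x :=
  Gm_position c0 (erefl (Gm x)) (zz ex) (Bz ex) (beta_position ex).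
move: (Q x) (Bz ex) GmF; rewrite /Omega_phi.
move: (B x) (Gm x) (F x) (Phi_mx X x) (invmx _) => B0 G0 F0 k0 Oi q Bz0 GmF.
have BkF : (B0 *m k0)^T *m G *m F0 = 0.
  by rewrite trmx_mul -2!(mulmxA k0^T) Bz0 mulmx0.
rewrite mulmxBl -(mulmxA (G0 *m Oi)) BkF mulmx0 subr0.
rewrite mulNmx -(mulmxA _ _ F0) GmF.
by rewrite !mulmxBr !mulmxA addrC.
Qed.

Lemma dmx_transform x : cdom e x -> dmx e Ft x = Q x *m B x *m tangent_factor x.
Proof.
move=> ex; apply: mulmx_vec_inj => X.
rewrite (dmxE X sFt ex (I x)) dd_transform // -(mulmxA _ (tangent_factor x) X).
by rewrite tangent_factorE // mulmxA.
Qed.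

Let OmSym x : cdom e x -> Omega x + (Omega x)^T = (Gm x)^T *m G *m Gm x.
Proof. by move=> ex; exact (rd_Omega_sym hR Ae ex). Qed.

Lemma transform_quadric x : cdom e x -> bform G (Ft x) (Ft x) = c^-1.
Proof.
move=> ex; rewrite transform_op // (bform_ribaucour_op (rd_Omega_unit hR x) (OmSym ex)).
exact: quadric_norm.
Qed.

Lemma transform_metric x : cdom e x ->
  induced_metric eps Ft e x = (tangent_factor x)^T *m g e x *m tangent_factor x.
Proof.
move=> ex; rewrite /induced_metric dmx_transform // metric_induced //.
have iso := ribaucour_op_isometry (rd_Omega_unit hR x) (OmSym ex).
rewrite /induced_metric; move: (Q x) (B x) (tangent_factor x) iso => q B0 D0 iso.
by rewrite -[in RHS]iso !trmx_mul !mulmxA.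
Qed.

(** The Leibniz rule applied to d f~ = Q f_* D. *)
Lemma transform_second_derivative X Y xi x : cdom e x ->
  (B x)^T *m G *m xi = 0 ->
  bform G (dd e X (dmx e Ft) x *m Y) (Q x *m xi) =
  bform G (dd e X B x *m (tangent_factor x *m Y)) xi +
  bform (g e x) (tangent_factor x *m Y)
    (Phi_mx X x *m (invmx (Omega x) *m ((Gm x)^T *m G *m xi))).
Proof.
move=> ex Bxi; have Ix := I x.
have sa : smooth Omega_phi by exact: smooth_on_mulmx.
have ska : smooth (fun y => Phi_mx Y y *m Omega_phi y) by exact: smooth_on_mulmx.
have sd : smooth (fun y => Y - Phi_mx Y y *m Omega_phi y).
  by apply: smooth_onB => //; exact: smooth_on_cst.
have sBd : smooth (fun y => B y *m (Y - Phi_mx Y y *m Omega_phi y)) by exact: smooth_on_mulmx.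
have h y : cdom e y -> [set: M] y ->
    dd e Y Ft y = Q y *m (B y *m (Y - Phi_mx Y y *m Omega_phi y)).
  by move=> ey _; exact: dd_transform.
have E1 := etrans (esym (dd_dd_dmx oT X Y sFt ex Ix)) (etrans (dd_ext oT X h ex Ix)
  (etrans (dd_mulmx X sQ sBd ex Ix) (congr2 (fun s t => s + t) (erefl _)
  (congr1 (mulmx (Q x)) (dd_mulmx X sB sd ex Ix))))).
apply: (etrans (congr1 (fun w => bform G w (Q x *m xi)) E1)).
rewrite -(tangent_factorE Y ex).
exact: (transformed_second_derivative (metric_induced ex Ix) (rd_Omega_unit hR x)
  (OmSym ex) _ _ _ (dd_calG_tangent X ex) (dd_ribaucour_op X ex) Bxi).
Qed.

(** ** Horizontality of the P-transforms *)

Variable P : 'M[R]_k.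
Hypotheses (hc : 0 < eps * c) (PU : P \in unitmx).
Hypothesis ptbeta : forall x v, cdom e x ->
  beta x *m v = P_beta eps c g F phi P e x v.
Hypothesis ptOmega : forall x, cdom e x ->
  (Omega x)^T *m P + P^T *m (Omega x)^T + P_T P *m P_rho c g phi P e x = 0.
Let BJz x (ex : cdom e x) := hopf_normal sF hor' ex (I x).

Let eps_norm : eps * `|c| = c.
Proof.
case: heps hc => ->; rewrite ?mul1r ?mulN1r; first by move=> /gtr0_norm.
by rewrite oppr_gt0 => /ltr0_norm ->; rewrite opprK.
Qed.

Lemma beta_complex x : cdom e x ->
  beta x = J *m (B x *m omega_t g phi e x + c *: (F x *m (phi x)^T)) *m P.
Proof.
move=> ex; apply: mulmx_vec_inj => v; rewrite ptbeta // /P_beta /phi_op.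
rewrite /quadric_proj /xi_at; set u := omega_t g phi e x *m (P *m v).
have -> : inner eps (F x) (J *m (B x *m u)) = 0.
  rewrite -[LHS]/(bform G (F x) (J *m (B x *m u))).
  rewrite -[LHS]opprK -inner_Jmxl symG bform_mull BJz //.
  by rewrite mulmx0 mxE oppr0.
rewrite mulr0 scale0r subr0 scalerA.
have -> : eps * Num.sqrt `|c| * ((phi x)^T *m (P *m v)) 0 0 * Num.sqrt `|c| =
    c * ((phi x)^T *m (P *m v)) 0 0.
  by rewrite -[in RHS]eps_norm -[in RHS](sqr_sqrtr (normr_ge0 c)); ring.
rewrite -!mulmxA mulmxDl !mulmxDr -scalemxAl -scalemxAr /u !mulmxA; congr (_ + _).
rewrite -scalerA; congr (_ *: _).
have -> : J *m F x *m (phi x)^T *m P *m v = J *m F x *m ((phi x)^T *m P *m v).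
  by rewrite !mulmxA.
by rewrite [X in _ = _ *m X]mx11_scalar mul_mx_scalar.
Qed.

Lemma transform_horizontal X x : cdom e x ->
  bform G (J *m Ft x) (dd e X Ft x) = 0.
Proof.
move=> ex; have Ix := I x.
have := ribaucour_horizontal_at c0 (metric_induced ex Ix) (metric_unit ex Ix)
  (erefl (omega_t g phi e x)) (erefl (Gm x)) (zz ex) (Bz ex) (beta_tangent ex)
  (beta_position ex) (rd_Omega_unit hR x) (OmSym ex) PU (BJz ex) (BJB ex)
  (erefl _) (beta_complex ex) (erefl _).
rewrite transform_op // dd_transform //.
move: (Q x) (X - _) => q d hh.
have e1 : J *m (q *m (B x *m d)) = J *m (q *m B x) *m d by rewrite !mulmxA.
rewrite inner_Jmxl e1 /bform (mulmxA _ _ d) hh ?mul0mx ?mxE ?oppr0 //.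
have := ptOmega ex; rewrite /P_T /P_rho => <-; congr (_ + _ *m _).
by rewrite mulmxDr mulmxDl -scalemxAr -scalemxAl !mulmxA.
Qed.

Variable Mt : set M.
Hypothesis oMt : open Mt.
Let gt : metric R n M := induced_metric eps Ft.
Hypothesis gtU : forall y, cdom e y -> Mt y -> gt e y \in unitmx.

Lemma smooth_transform_on : smooth_on e Mt Ft.
Proof.
move=> j; apply: Ck_sub (sFt j) => _ [y [ey _] <-].
by exists y.
Qed.
Let sFt' := smooth_transform_on.

Let gtE x : cdom e x -> Mt x -> gt e x = induced_metric eps Ft e x.
Proof. by []. Qed.
Let horFt x X : cdom e x -> Mt x -> bform G (J *m Ft x) (dd e X Ft x) = 0.
Proof. by move=> ex _; exact: transform_horizontal. Qed.
Local Notation At := (sff_product eps e Ft gt).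

Let gtD x X Y : cdom e x ->
  bform (gt e x) X Y = bform (g e x) (tangent_factor x *m X) (tangent_factor x *m Y).
Proof. by move=> ex; rewrite bform_pull /gt transform_metric. Qed.

Let D_unit x : cdom e x -> Mt x -> tangent_factor x \in unitmx.
Proof.
move=> ex Mx; have := gtU ex Mx; rewrite /gt transform_metric //.
by rewrite unitmx_mul => /andP[_].
Qed.

Implicit Types X Y Z W V : 'cV[R]_n.
Let D_multiplier x X Y : cdom e x ->
  tangent_factor x *m (Ap x X *m Y) = Ap x X *m (tangent_factor x *m Y).
Proof.
move=> ex.
apply: (etrans (tangent_factorE _ ex)); apply: (etrans _ (congr1 _ (esym (tangent_factorE Y ex)))).
apply: (etrans _ (esym (mulmxBr _ _ _))).
exact (congr1 (fun w => _ - w) (Phi_mx_multiplier X Y (Omega_phi x) ex)).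
Qed.

Let Ap_selfadjoint x X Y Z : cdom e x ->
  bform (g e x) (Ap x X *m Y) Z = bform (g e x) Y (Ap x X *m Z).
Proof.
move=> ex; apply: (product_selfadjoint (A := Ap x) (metric_symmetric ex)).
move=> X1 Y1 Z1; exact (sff_product_invariant oT sF hor' metric_induced
    metric_unit X1 Y1 Z1 ex (I x)).
Qed.

(** The vector xi with Q xi = J f~_* Z, which is normal to f. *)
Let xi x (Z : 'cV[R]_n) := invmx (Q x) *m (J *m (dmx e Ft x *m Z)).

Let Q_unit x : cdom e x -> Q x \in unitmx.
Proof.
move=> ex; have := gramC_unit n heps.
rewrite -(ribaucour_op_isometry (rd_Omega_unit hR x) (OmSym ex)).
by rewrite unitmx_mul => /andP[_].
Qed.

Let Q_xi x Z : cdom e x -> Q x *m xi x Z = J *m (dmx e Ft x *m Z).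
Proof. by move=> ex; rewrite /xi mulKVmx // Q_unit. Qed.

Let B_xi x Z : cdom e x -> Mt x -> (B x)^T *m G *m xi x Z = 0.
Proof.
move=> ex Mx; apply: col_dual_eq0 => u.
rewrite -bform_mull -(bform_ribaucour_op (rd_Omega_unit hR x) (OmSym ex)) Q_xi //.
have -> : Q x *m (B x *m u) = dmx e Ft x *m (invmx (tangent_factor x) *m u).
  by rewrite dmx_transform // -!mulmxA mulKVmx // D_unit.
rewrite bform_mull (mulmxA J) (mulmxA _ (J *m _) Z) (isotropic oMt sFt' horFt ex Mx).
by rewrite mul0mx mulmx0 mxE.
Qed.

Let cubicFt x X Y Z : cdom e x -> Mt x ->
  bform (gt e x) (At x X *m Y) Z =
  bform G (dd e X B x *m (tangent_factor x *m Y)) (xi x Z) +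
  bform (g e x) (tangent_factor x *m Y)
    (Phi_mx X x *m (invmx (Omega x) *m ((Gm x)^T *m G *m xi x Z))).
Proof.
move=> ex Mx.
have gtsym : (gt e x)^T = gt e x by rewrite /gt /induced_metric gram_tr.
apply: (etrans (bformC gtsym _ _)).
apply: (etrans (sff_productE eps Ft gtU X Y Z ex Mx)).
apply: (etrans (symG _ _)).
apply: (etrans (congr1 (bform G _) (esym (Q_xi Z ex)))).
exact: (transform_second_derivative X Y ex (B_xi Z ex Mx)).
Qed.

Let second_normal x X V Z : cdom e x -> Mt x ->
  bform G (dd e X B x *m V) (xi x Z) =
  bform G (J *m (B x *m (Ap x X *m V))) (xi x Z) -
  c * bform (g e x) X V * bform G (F x) (xi x Z).
Proof.
move=> ex Mx.
have := flat_sff_horizontal heps c0 oT sF quadric_norm hor' metric_induced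
  metric_unit X V ex (I x).
move=> /(congr1 (fun w => bform G w (xi x Z))).
rewrite /flat_sff bformBl (bform_mull G (B x)) B_xi // mulmx0 [_ 0 0]mxE subr0 => ->.
by rewrite bformBl bformZl.
Qed.

(** The transformed cubic form involves X and Y only through the multiplications
    of f and the operators D and Phi_v, which commute with them. *)
Lemma transform_flat x : cdom e x -> Mt x ->
  (forall X Y, bform (g e x) (Ap x X *m X) (Ap x Y *m Y) =
               bform (g e x) (Ap x X *m Y) (Ap x X *m Y)) ->
  (forall X, (forall Y : 'cV_n, Ap x X *m Y = 0) -> X = 0) ->
  forall X Y, bform (gt e x) (At x X *m X) (At x Y *m Y) =
              bform (gt e x) (At x X *m Y) (At x X *m Y).
Proof.
move=> ex Mx flat null.
have gtsym : (gt e x)^T = gt e x by rewrite /gt /induced_metric gram_tr.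
have ApC X Y : Ap x X *m Y = Ap x Y *m X by exact (sff_productC eps oT sF g X Y ex (I x)).
have Apinv X Y Z : bform (g e x) (Ap x X *m Y) Z = bform (g e x) (Ap x X *m Z) Y.
  exact (sff_product_invariant oT sF hor' metric_induced metric_unit X Y Z ex (I x)).
have assoc := flat_product_assoc (metric_symmetric ex) (metric_unit ex (I x)) ApC Apinv flat.
apply: (invariant_product_flat (A := Ap x) (At := At x) (metric_symmetric ex)
  (metric_unit ex (I x)) ApC Apinv null gtsym (gtU ex Mx)).
- move=> X Y; exact (sff_productC eps oMt sFt' gt X Y ex Mx).
- move=> X Y Z; exact (sff_product_invariant oMt sFt' horFt gtE gtU X Y Z ex Mx).
- by move=> X Y Z; rewrite !gtD // !D_multiplier // Ap_selfadjoint.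
- move=> X Y Z W.
  apply: (etrans (cubicFt _ _ _ ex Mx)); apply: (etrans _ (esym (cubicFt _ _ _ ex Mx))).
  set v := invmx _ *m _; set d := tangent_factor x *m Y.
  have e1 : tangent_factor x *m (Ap x W *m Y) = Ap x W *m d := D_multiplier W Y ex.
  have e2 : Ap x (Ap x X *m W) *m d = Ap x X *m (tangent_factor x *m (Ap x W *m Y)) :=
    etrans (esym (assoc X W d)) (congr1 (mulmx (Ap x X)) (esym e1)).
  have e3 : bform (g e x) (Ap x X *m W) d =
      bform (g e x) X (tangent_factor x *m (Ap x W *m Y)) :=
    etrans (congr1 (fun u => bform (g e x) u d) (ApC X W))
    (etrans (Ap_selfadjoint W X d ex) (congr1 (bform (g e x) X) (esym e1))).
  have e4 : Phi_mx (Ap x X *m W) x *m v = Ap x W *m (Phi_mx X x *m v) :=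
    etrans (congr1 (fun u => Phi_mx u x *m v) (ApC X W)) (Phi_mx_multiplier W X v ex).
  have e5 : bform (g e x) d (Phi_mx (Ap x X *m W) x *m v) =
      bform (g e x) (tangent_factor x *m (Ap x W *m Y)) (Phi_mx X x *m v) :=
    etrans (congr1 (bform (g e x) d) e4)
    (etrans (esym (Ap_selfadjoint W d (Phi_mx X x *m v) ex))
    (congr1 (fun u => bform (g e x) u (Phi_mx X x *m v)) (esym e1))).
  apply: (congr2 (fun s t => s + t) _ e5).
  apply: (etrans (second_normal _ _ _ ex Mx)).
  apply: (etrans _ (esym (second_normal _ _ _ ex Mx))).
  exact (congr2 (fun u s => bform G (J *m (B x *m u)) (xi x Z) -
    c * s * bform G (F x) (xi x Z)) e2 e3).
Qed.

End RibaucourChart.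

(** * Constant curvature and regular points *)

Section RankTwo.
Variables (R : realFieldType) (n : nat).
Implicit Types X Y : 'cV[R]_n.

Lemma row_mx2_mul X Y (a b : R) :
  row_mx X Y *m col_mx a%:M b%:M = a *: X + b *: Y.
Proof. by rewrite mul_row_col !mul_mx_scalar. Qed.

Lemma rank2_indep X Y a b : \rank (row_mx X Y) = 2%N -> a *: X + b *: Y = 0 ->
  a = 0 /\ b = 0.
Proof.
move=> r2; rewrite -row_mx2_mul => /(congr1 trmx); rewrite trmx_mul trmx0 => h.
have fr : row_free (row_mx X Y)^T by rewrite /row_free mxrank_tr r2.
move: h => /eqP; rewrite mulmx_free_eq0 // => /eqP /(congr1 trmx).
rewrite trmxK trmx0 -col_mx0 => /eq_col_mx[/matrixP a0 /matrixP b0].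
by have := a0 0 0; have := b0 0 0; rewrite !mxE !mulr1n.
Qed.

Lemma rank2_dep X Y : \rank (row_mx X Y) != 2%N ->
  exists a b, [/\ a *: X + b *: Y = 0 & (a != 0) || (b != 0)].
Proof.
move=> r2; have : ~~ row_free (row_mx X Y)^T by rewrite /row_free mxrank_tr.
rewrite -kermx_eq0 => /rowV0Pn[w /sub_kermxP wk w0].
exists (lsubmx w 0 0), (rsubmx w 0 0).
have wE : w^T = col_mx (lsubmx w 0 0)%:M (rsubmx w 0 0)%:M.
  rewrite -[in LHS](hsubmxK w) tr_row_mx.
  by rewrite -!mx11_scalar; congr col_mx; apply/matrixP => i j; rewrite !ord1 mxE.
split.
  rewrite -row_mx2_mul -wE; apply: trmx_inj.
  by rewrite trmx_mul trmxK wk trmx0.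
rewrite -negb_and; apply: contra w0 => /andP[/eqP a0 /eqP b0].
by rewrite -(trmxK w) wE a0 b0 !raddf0 col_mx0 trmx0.
Qed.

(** Strict Cauchy-Schwarz: <X,X> Y - <X,Y> X has positive norm. *)
Lemma gram_det_gt0 (S : 'M[R]_n) X Y : S^T = S ->
  (forall Z, Z != 0 -> 0 < bform S Z Z) -> \rank (row_mx X Y) = 2%N ->
  0 < bform S X X * bform S Y Y - bform S X Y ^+ 2.
Proof.
move=> Ssym pos r2.
have X0 : X != 0.
  apply/eqP => X0; have [] := @rank2_indep X Y 1 0 r2.
    by rewrite X0 scaler0 scale0r addr0.
  by move=> /eqP; rewrite oner_eq0.
have pX := pos X X0.
pose Z := (- bform S X Y) *: X + bform S X X *: Y.
have Z0 : Z != 0.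
  apply/eqP => /(rank2_indep r2)[_ h]; by rewrite h ltxx in pX.
have := pos Z Z0; rewrite /Z !bformE (bformC Ssym Y X) => pZ.
by rewrite -(pmulr_rgt0 _ pX); move: pZ; congr (_ < _); ring.
Qed.

End RankTwo.

(** An eigenvalue 0 would be opposite to itself. *)
Lemma spectrum_unit (R : realType) k (P : 'M[R]_k) :
  (forall z, complex_eigenvalue P z -> ~ complex_eigenvalue P (- z)) ->
  P \in unitmx.
Proof.
move=> sP; rewrite -unitmx_tr unitmxE unitfE; apply/negP => /det0P[v v0 vP].
have ev : complex_eigenvalue P 0.
  exists (map_mx (real_complex R) v^T); first by rewrite map_mx_eq0 trmx_eq0.
  rewrite scale0r -map_mxM -[P *m _]trmxK trmx_mul trmxK vP trmx0.
  by rewrite map_mx0.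
by apply: (sP 0 ev); rewrite oppr0.
Qed.

Section ChartChange.
Variables (R : realType) (n : nat) (M : topologicalType).
Variables (A : set (chart R n M)).
Hypothesis hA : smooth_manifold A.

Lemma dd_chart_change (W : normedModType R) e e' (h : M -> W) X x :
  A e -> A e' -> smooth_on e' setT h -> cdom e x -> cdom e' x ->
  dd e X h x = dd e' (dd e X (cmap e') x) h x.
Proof.
move=> Ae Ae' sh ex ex'.
have oe' : open (cdom e') := @cdom_open _ _ _ e'.
have st : smooth_on e (cdom e') (cmap e') := mfd_transition hA Ae Ae'.
have tE : (cmap e' \o cinv e) (cmap e x) = cmap e' x by rewrite /= cmapK.
have dt := smooth_on_diff st ex ex'.
have dh := smooth_on_diff sh ex' Logic.I.
rewrite /dd -[in RHS]tE -derive_comp //; last by rewrite tE.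
apply: near_eq_derive.
have Dx : (cmap e @` (cdom e `&` cdom e')) (cmap e x) by exists x.
apply: filterS (open_nbhs_nbhs (conj (open_chart_image (e := e) oe') Dx)).
by move=> _ [y [ey ey'] <-]; rewrite /= cmapK // cmapK.
Qed.

Lemma dmx_chart_change p e e' (h : M -> 'cV[R]_p) x :
  A e -> A e' -> smooth_on e setT h -> smooth_on e' setT h ->
  cdom e x -> cdom e' x ->
  dmx e h x = dmx e' h x *m dmx e (cmap e') x.
Proof.
move=> Ae Ae' sh sh' ex ex'; apply: mulmx_vec_inj => X.
have oe' : open (cdom e') := @cdom_open _ _ _ e'.
have st : smooth_on e (cdom e') (cmap e') := mfd_transition hA Ae Ae'.
rewrite -mulmxA (dmxE X st ex ex') (dmxE _ sh' ex' Logic.I) (dmxE X sh ex Logic.I).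
exact: dd_chart_change.
Qed.

End ChartChange.

(** * P-transforms *)

(** As alpha(X, Y) = J f_* (X.Y), the annihilator of the product is the relative
    nullity. *)
Lemma product_null (R : realType) (n : nat) (M : topologicalType) (eps c : R)
    (e : chart R n M) (F : M -> 'cV[R]_(Cdim n)) (g : metric R n M)
    (Ap : 'cV[R]_n -> 'M[R]_n) x X :
  (forall Y Z, sff eps c g F e Y Z x = Jmx R n *m (dmx e F x *m (Ap Y *m Z))) ->
  (forall Y (Z : 'cV_n), Ap Y *m Z = Ap Z *m Y) ->
  relative_nullity eps c g F e x = 0%N ->
  (forall Y : 'cV_n, Ap X *m Y = 0) -> X = 0.
Proof.
move=> sffE ApC /eqP; rewrite /relative_nullity mxrank_eq0 kermx_eq0 => fr null.
suff h : X^T *m sff_mx eps c g F e x = 0.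
  by move: h => /eqP; rewrite mulmx_free_eq0 // trmx_eq0 => /eqP.
apply/rowP => l; case/mxvec_indexP: l => j a.
pose N := Jmx R n *m dmx e F x *m Ap (delta_mx j 0).
have Nz : (N *m X) a 0 = 0.
  by rewrite /N -mulmxA -ApC null mulmx0 mxE.
rewrite [RHS]mxE -Nz [LHS]mxE [RHS]mxE; apply: eq_bigr => i _.
rewrite [X^T _ _]mxE [sff_mx _ _ _ _ _ _ _ _]mxE mxvecE mxE sffE ApC mulrC.
by congr (_ * _); rewrite !mulmxA -/N -colE mxE.
Qed.

Lemma curvature_quotient (R : fieldType) (num d s1 s2 c : R) :
  d != 0 -> num / d = c -> num = s1 - s2 + c * d -> s1 = s2.
Proof.
move=> d0 h numE; have := divfK d0 num; rewrite h numE => /eqP.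
by rewrite eq_sym -subr_eq0 addrK subr_eq0 => /eqP.
Qed.

Lemma curvature_value (R : fieldType) (num d s1 s2 c : R) :
  d != 0 -> num = s1 - s2 + c * d -> s1 = s2 -> num / d = c.
Proof. by move=> d0 -> ->; rewrite subrr add0r mulfK. Qed.

Lemma dependent_flat (R : realFieldType) n (S : 'M[R]_n) (Ap : 'cV[R]_n -> 'M[R]_n)
    (X Y : 'cV[R]_n) a b :
  (forall X (Y : 'cV_n), Ap X *m Y = Ap Y *m X) ->
  a *: X + b *: Y = 0 -> (a != 0) || (b != 0) ->
  bform S (Ap X *m X) (Ap Y *m Y) = bform S (Ap X *m Y) (Ap X *m Y).
Proof.
move=> ApC ab; have [b0|b0] := eqVneq b 0.
  rewrite orbF => a0; have -> : X = 0.
    move: ab; rewrite b0 scale0r addr0 => /eqP.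
    by rewrite scaler_eq0 (negPf a0) => /eqP.
  by rewrite mulmx0 ApC mulmx0 !bform0l.
move=> _; have -> : Y = (- (a / b)) *: X.
  apply: (scalerI b0); rewrite scalerA mulrN mulrC divfK // scaleNr.
  by apply/eqP; rewrite -addr_eq0 addrC ab.
rewrite (ApC _ (_ *: X)) -!scalemxAr (ApC _ X) -!scalemxAr.
by rewrite !(bformZl, bformZr); ring.
Qed.

Section PTransform.
Variables (R : realType) (n k : nat) (M : topologicalType) (eps c : R).
Hypotheses (heps : eps = 1 \/ eps = -1) (hc : 0 < eps * c).
Variables (A : set (chart R n M)) (g : metric R n M).
Hypotheses (hA : smooth_manifold A) (hg : riemannian_metric A setT g).
Hypothesis hgc : constant_curvature A setT g c.
Variable F : M -> 'cV[R]_(Cdim n).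
Hypothesis hF : isometric_immersion eps c A setT g F.
Hypothesis hFh : horizontal eps c A setT F.
Hypothesis hnu : forall e x, A e -> cdom e x -> relative_nullity eps c g F e x = 0%N.
Variables (phi : M -> 'cV[R]_k) (beta : M -> 'M[R]_(Cdim n, k)) (Omega : M -> 'M[R]_k).
Variables (P : 'M[R]_k) (Ft : M -> 'cV[R]_(Cdim n)).
Hypothesis hP : P_transform eps c A g F phi beta Omega P Ft.
Local Notation G := (gramC n eps).
Local Notation J := (Jmx R n).
Local Notation Mt := (regular_points A Ft).
Local Notation gt := (induced_metric eps Ft).
Local Notation D e := (tangent_factor eps c g F phi beta Omega e).
Implicit Types (e : chart R n M) (x : M) (X Y Z : 'cV[R]_n).
Let I x : [set: M] x := Logic.I.
Let oT : open [set: M] := openT.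

Let c0 : c != 0.
Proof. by apply/eqP => c00; move: hc; rewrite c00 mulr0 ltxx. Qed.

Let sqrtc0 : Num.sqrt `|c| != 0.
Proof. by rewrite sqrtr_eq0 -ltNge normr_gt0. Qed.

Lemma horizontal_inner e x X (H : M -> 'cV[R]_(Cdim n)) :
  inner eps (xi_at c (H x)) (dd e X H x) =
  Num.sqrt `|c| * bform G (J *m H x) (dd e X H x).
Proof. exact: bformZl. Qed.

Let hor e x X : A e -> cdom e x -> bform G (J *m F x) (dd e X F x) = 0.
Proof.
move=> Ae ex; have := hFh X Ae ex (I x); rewrite horizontal_inner => /eqP.
by rewrite mulf_eq0 (negPf sqrtc0) => /eqP.
Qed.

Let hR := (pt_ribaucour hP).1.
Let FtE e (Ae : A e) x (ex : cdom e x) := (pt_ribaucour hP).2 e x Ae ex.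
Let PU := spectrum_unit (pt_spectrum hP).
Let ptb e (Ae : A e) x v (ex : cdom e x) := pt_beta hP v Ae ex.
Let ptO e (Ae : A e) x (ex : cdom e x) := pt_Omega hP Ae ex.

Let sFt e (Ae : A e) : smooth_on e setT Ft := smooth_transform c0 hg hF hR Ae (FtE Ae).
Let gtE e (Ae : A e) x (ex : cdom e x) :
  gt e x = (D e x)^T *m g e x *m D e x := transform_metric c0 hg hF hR Ae (FtE Ae) ex.

Let gt_sym e x : (gt e x)^T = gt e x.
Proof. by rewrite /induced_metric gram_tr. Qed.

(** As d f~ = Q f_* D with Q isometric, the rank drops exactly where D, or
    equivalently the induced metric D^t g D, degenerates. *)
Lemma regular_unit e x : A e -> cdom e x ->
  (\rank (dmx e Ft x) == n) = (gt e x \in unitmx).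
Proof.
move=> Ae ex; apply/idP/idP => [/eqP r|u].
  have DU : D e x \in unitmx.
    rewrite -row_free_unit -row_leq_rank -{1}r (dmx_transform c0 hg hF hR Ae (FtE Ae) ex).
    exact: mxrankM_maxr.
  by rewrite gtE // !unitmx_mul unitmx_tr DU (metric_unit hg Ae ex (I x)).
rewrite eqn_leq rank_leq_col -{1}(mxrank_unit u) /induced_metric.
exact: mxrankM_maxr.
Qed.

Lemma regular_chart e x : A e -> cdom e x -> gt e x \in unitmx -> Mt x.
Proof.
move=> Ae ex; rewrite -regular_unit // => /eqP r e' Ae' ex'.
apply/eqP; rewrite eqn_leq rank_leq_col -{1}r.
rewrite (dmx_chart_change hA Ae Ae' (sFt Ae) (sFt Ae') ex ex').
exact: mxrankM_maxl.
Qed.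

Let gtU e (Ae : A e) x : cdom e x -> Mt x -> gt e x \in unitmx.
Proof. by move=> ex Mx; rewrite -regular_unit //; apply/eqP; exact: Mx. Qed.

Let sgtT e (Ae : A e) : smooth_on e setT (gt e).
Proof. by apply: smooth_on_gram => //; apply: smooth_on_dmx => //; exact: sFt. Qed.

(** In one chart the nonvanishing of the determinant of the induced metric is an
    open condition; regular_chart carries it to the other charts. *)
Lemma open_regular : open Mt.
Proof.
rewrite openE => x Mx; have [e Ae ex] := mfd_cover hA x.
have u := gtU Ae ex Mx.
have cdet : {for cmap e x, continuous ((fun y => \det (gt e y)) \o cinv e)}.
  have oD : open (cmap e @` (cdom e `&` setT)) := open_chart_image oT.
  by apply: (Csmooth_det oD (sgtT Ae) 0%N); exists x.
have cm := cmap_continuous ex.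
pose f := ((fun y => \det (gt e y)) \o cinv e) \o cmap e.
have cf : {for x, continuous f} := continuous_comp cm cdet.
have n0 : nbhs (f x) [set r : R | r != 0].
  apply: open_nbhs_nbhs; split; first exact: open_neq.
  by rewrite /f /= cmapK // -unitfE -unitmxE.
have nx := cf _ n0.
have ne : nbhs x (cdom e) := open_nbhs_nbhs (conj (@cdom_open _ _ _ e) ex).
rewrite /interior /=; apply: filterS2 ne nx => y ey.
rewrite /f /= cmapK // => d0; apply: (regular_chart Ae ey).
by rewrite unitmxE unitfE.
Qed.
Let oMt := open_regular.

Let sFtM e (Ae : A e) : smooth_on e Mt Ft :=
  smooth_transform_on c0 hg hF hR Ae (FtE Ae) Mt.

Let gt_pos e x X : A e -> cdom e x -> Mt x -> X != 0 -> 0 < gin gt e x X X.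
Proof.
move=> Ae ex Mx X0; have u := gtU Ae ex Mx.
rewrite -[gin _ _ _ _ _]/(bform (gt e x) X X) gtE // -bform_pull.
apply: (rm_pos hg Ae ex (I x)); apply: contra X0 => /eqP DX.
move: u; rewrite gtE // unitmx_mul => /andP[_ DU].
by rewrite -[X](mulKmx DU) DX mulmx0.
Qed.

Lemma transform_riemannian : riemannian_metric A Mt gt.
Proof.
split=> [e Ae|e x _ _ _|e x X|e e' x Ae Ae' ex ex' Mx].
- by apply: smooth_on_gram => //; apply: smooth_on_dmx => //; exact: sFtM.
- exact: gt_sym.
- exact: gt_pos.
rewrite /induced_metric (dmx_chart_change hA Ae Ae' (sFt Ae) (sFt Ae') ex ex').
by rewrite trmx_mul !mulmxA.
Qed.

Lemma transform_immersion : isometric_immersion eps c A Mt gt Ft.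
Proof.
split=> [e Ae|x Mx|//]; first exact: sFtM.
have [e Ae ex] := mfd_cover hA x.
exact: (transform_quadric c0 hF hR Ae (FtE Ae) ex).
Qed.

Let horFt e (Ae : A e) X x (ex : cdom e x) :=
  transform_horizontal heps c0 hg hF hor hR Ae (FtE Ae) hc PU (ptb Ae) (ptO Ae) X ex.

Lemma transform_is_horizontal : horizontal eps c A Mt Ft.
Proof.
move=> e x X Ae ex Mx.
by rewrite horizontal_inner horFt // mulr0.
Qed.

Let hor' e (Ae : A e) x X : cdom e x -> [set: M] x ->
  bform G (J *m F x) (dd e X F x) = 0.
Proof. by move=> ex _; exact: hor. Qed.

(** The curvature c of the metric cancels that of the quadric in the Gauss
    equation.  For dependent X and Y, which span no plane, both sides agree by
    bilinearity. *)
Lemma product_flat e x X Y : A e -> cdom e x ->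
  bform (g e x) (sff_product eps e F g x X *m X) (sff_product eps e F g x Y *m Y) =
  bform (g e x) (sff_product eps e F g x X *m Y) (sff_product eps e F g x X *m Y).
Proof.
move=> Ae ex; have sF : smooth_on e setT F := ii_smooth hF Ae.
have [r2|r2] := eqVneq (\rank (row_mx X Y)) 2%N; last first.
  have [a [b [ab nz]]] := rank2_dep r2.
  apply: (dependent_flat (Ap := sff_product eps e F g x) _ _ ab nz).
  by move=> X1 Y1; exact (sff_productC eps oT sF g X1 Y1 ex (I x)).
have d0 := gram_det_gt0 (metric_symmetric hg Ae ex)
  (fun Z hZ => rm_pos hg Ae ex (I x) hZ) r2.
exact (curvature_quotient (lt0r_neq0 d0) (hgc Ae ex (I x) r2)
  (horizontal_curvature heps c0 oT sF (quadric_norm hF (e := e)) (hor' Ae)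
    (metric_induced hF Ae) (metric_unit hg Ae) X Y ex (I x))).
Qed.

(** The same cancellation, read backwards for the transform. *)
Lemma transform_constant_curvature : constant_curvature A Mt gt c.
Proof.
move=> e x X Y Ae ex Mx r2; have sF : smooth_on e setT F := ii_smooth hF Ae.
have d0 := gram_det_gt0 (gt_sym e x) (fun Z hZ => gt_pos Ae ex Mx hZ) r2.
have null Z : (forall Y : 'cV_n, sff_product eps e F g x Z *m Y = 0) -> Z = 0.
  apply: (product_null _ _ (hnu Ae ex)).
    move=> Y1 Z1; exact (sff_cubic heps c0 oT sF (quadric_norm hF (e := e)) (hor' Ae)
      (metric_induced hF Ae) (metric_unit hg Ae) Y1 Z1 ex (I x)).
  by move=> X1 Y1; exact (sff_productC eps oT sF g X1 Y1 ex (I x)).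
have flat := transform_flat heps c0 hg hF hor hR Ae (FtE Ae) hc PU (ptb Ae) (ptO Ae)
  oMt (fun y ey My => gtU Ae ey My) ex Mx (fun X Y => product_flat X Y Ae ex) null X Y.
have curv := horizontal_curvature heps c0 oMt (sFtM Ae)
  (fun y ey _ => transform_quadric c0 hF hR Ae (FtE Ae) ey)
  (fun y Z ey _ => horFt Ae Z ey) (g := gt) (fun _ _ _ => erefl _)
  (fun y ey My => gtU Ae ey My) X Y ex Mx.
exact (curvature_value (lt0r_neq0 d0) curv flat).
Qed.

End PTransform.

Theorem theorem62 (R : realType) (n k : nat) (M : topologicalType)
    (eps c : R) (heps : eps = 1 \/ eps = -1) (hc : 0 < eps * c)
    (A : set (chart R n M)) (hA : smooth_manifold A)
    (g : metric R n M) (hg : riemannian_metric A setT g)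
    (hgc : constant_curvature A setT g c)
    (F : M -> 'cV[R]_(Cdim n))
    (hF : isometric_immersion eps c A setT g F)
    (hFh : horizontal eps c A setT F)
    (hnu : forall e x, A e -> cdom e x -> relative_nullity eps c g F e x = 0%N)
    (phi : M -> 'cV[R]_k) (beta : M -> 'M[R]_(Cdim n, k)) (Omega : M -> 'M[R]_k)
    (P : 'M[R]_k) (Ft : M -> 'cV[R]_(Cdim n))
    (hP : P_transform eps c A g F phi beta Omega P Ft) :
  let Mt := regular_points A Ft in
  let gt := induced_metric eps Ft in
  [/\ open Mt, riemannian_metric A Mt gt, constant_curvature A Mt gt c,
      isometric_immersion eps c A Mt gt Ft & horizontal eps c A Mt Ft].
Proof.
split.
- exact: (open_regular hc hA hg hF hP).
- exact: (transform_riemannian hc hA hg hF hP).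
- exact: (transform_constant_curvature heps hc hA hg hgc hF hFh hnu hP).
- exact: (transform_immersion hc hA hg hF hP).
- exact: (transform_is_horizontal heps hc hg hF hFh hP).
Qed.
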